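(* Let $(M, g(t))$, $t\in [0, T]$, be a solution to the Ricci flow $\frac{\partial g_{ij}}{\partial t} = -2R_{ij}$ on a closed manifold $M$ of dimension $n$, and suppose that $g(t)$ has nonnegative scalar curvature. Let $f$ be a positive solution on $M\times[0,T]$ of the conjugate heat equation $$\frac{\partial f}{\partial t} = -\triangle_{g(t)} f + Rf.$$ Let $u=-\ln f$, $\tau = T-t$, and $$H = 2\triangle u - |\nabla u|^2 + R - 2\frac{n}{\tau}.$$ Then for all time $t\in[0,T)$, $H\le 0$ on $M$.
   Context: All geometric quantities are taken with respect to the evolving metric $g(t)$: $R_{ij}$ is the Ricci curvature, $R$ the scalar curvature, $\nabla$ the Levi-Civita connection, $\triangle=\triangle_{g(t)}$ the Laplace-Beltrami operator (trace of the Hessian), and $|\cdot|$ the norm of $g(t)$. Solutions are smooth. ''Closed'' means compact without boundary. *)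

(* Defs.v *)
From HB Require Import structures.
From mathcomp Require Import all_boot all_order all_algebra.
From mathcomp Require Import all_classical all_reals all_analysis.

Set Implicit Arguments.
Unset Strict Implicit.
Unset Printing Implicit Defensive.

Import Order.TTheory GRing.Theory Num.Theory.
Import numFieldNormedType.Exports.

Local Open Scope classical_set_scope.
Local Open Scope ring_scope.

(** * Calculus on open sets of R^n and on [0, T] x R^n *)

Section Smoothness.
Context {R : realType} {n : nat}.
Implicit Types (V : set 'rV[R]_n) (a : 'I_n).

Definition pderivable a (F : 'rV[R]_n -> R) (x : 'rV[R]_n) : Prop :=
  derivable F x (delta_mx 0 a).

Definition pderiv a (F : 'rV[R]_n -> R) (x : 'rV[R]_n) : R :=
  'D_(delta_mx 0 a) F x.

(* The class C^k on [V], meant for an open [V]. *)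
Fixpoint Ck_on V (k : nat) (F : 'rV[R]_n -> R) : Prop :=
  {within V, continuous F} /\
  if k is k'.+1 then
    forall a, (forall x, V x -> pderivable a F x) /\ Ck_on V k' (pderiv a F)
  else True.

Definition smooth_on V (F : 'rV[R]_n -> R) : Prop := forall k, Ck_on V k F.

(* The time derivative is taken relative to [0, T]: it is one-sided at the
   times 0 and T, and no value of [F] outside [0, T] matters. *)
Definition tquot (F : R -> 'rV[R]_n -> R) (t : R) (x : 'rV[R]_n) (s : R) : R :=
  (F s x - F t x) / (s - t).

Definition tderivable (T : R) (F : R -> 'rV[R]_n -> R) t x : Prop :=
  cvg (tquot F t x s @[s --> within [set s | 0 <= s <= T] t^']).

Definition tderiv (T : R) (F : R -> 'rV[R]_n -> R) t x : R :=
  lim (tquot F t x s @[s --> within [set s | 0 <= s <= T] t^']).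

(* The class C^k on [0, T] x V, up to both ends of the time interval. *)
Fixpoint Ck_spacetime (T : R) V (k : nat) (F : R -> 'rV[R]_n -> R) : Prop :=
  {within [set z : R * 'rV[R]_n | 0 <= z.1 <= T /\ V z.2],
    continuous (fun z : R * 'rV[R]_n => F z.1 z.2)} /\
  if k is k'.+1 then
    [/\ forall (t : R) x, 0 <= t <= T -> V x -> tderivable T F t x,
        Ck_spacetime T V k' (tderiv T F) &
        forall a,
          (forall (t : R) x, 0 <= t <= T -> V x -> pderivable a (F t) x) /\
          Ck_spacetime T V k' (fun t => pderiv a (F t))]
  else True.

Definition smooth_spacetime (T : R) V (F : R -> 'rV[R]_n -> R) : Prop :=
  forall k, Ck_spacetime T V k F.

End Smoothness.

(** * Riemannian geometry of a metric [G] = (G_ij) in local coordinates *)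

Section LocalGeometry.
Context {R : realType} {n : nat}.
Implicit Types (G : 'rV[R]_n -> 'M[R]_n) (u : 'rV[R]_n -> R) (x : 'rV[R]_n).

(* Gamma^k_ij *)
Definition christoffel G (k i j : 'I_n) x : R :=
  2^-1 * \sum_l invmx (G x) k l *
    (pderiv i (fun y => G y j l) x + pderiv j (fun y => G y i l) x
     - pderiv l (fun y => G y i j) x).

(* The component along the l-th coordinate field of R(d_i, d_j) d_k, where
   R(X, Y) = [nabla_X, nabla_Y] - nabla_[X, Y]. *)
Definition riemann G (l i j k : 'I_n) x : R :=
  pderiv i (christoffel G l j k) x - pderiv j (christoffel G l i k) x
  + \sum_m (christoffel G l i m x * christoffel G m j k x
            - christoffel G l j m x * christoffel G m i k x).

(* Ric(Y, Z) is the trace of X |-> R(X, Y) Z, hence positive on spheres. *)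
Definition ricci G (j k : 'I_n) x : R := \sum_i riemann G i i j k x.

Definition scalar_curvature G x : R :=
  \sum_i \sum_j invmx (G x) i j * ricci G i j x.

Definition hessian G u (i j : 'I_n) x : R :=
  pderiv i (pderiv j u) x - \sum_k christoffel G k i j x * pderiv k u x.

Definition laplacian G u x : R :=
  \sum_i \sum_j invmx (G x) i j * hessian G u i j x.

Definition grad_sqnorm G u x : R :=
  \sum_i \sum_j invmx (G x) i j * pderiv i u x * pderiv j u x.

End LocalGeometry.

(** * Manifolds and time-dependent metrics *)

(* A smooth atlas on [M] with values in R^n.  Every chart is a homeomorphism
   from an open set of [M] onto an open set of R^n, so there is no boundary.
   [chart_inv i] is only meaningful on the image of [chart_dom i]. *)
Record smooth_atlas (R : realType) (n : nat) (M : topologicalType) := SmoothAtlas {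
  chart : Type;
  chart_dom : chart -> set M;
  chart_map : chart -> M -> 'rV[R]_n;
  chart_inv : chart -> 'rV[R]_n -> M;
  chart_cover : forall p : M, exists i, chart_dom i p;
  chart_dom_open : forall i, open (chart_dom i);
  chart_image_open : forall i, open (chart_map i @` chart_dom i);
  chart_mapK : forall i p, chart_dom i p -> chart_inv i (chart_map i p) = p;
  chart_map_continuous : forall i,
    {within chart_dom i, continuous (chart_map i)};
  chart_inv_continuous : forall i,
    {within chart_map i @` chart_dom i, continuous (chart_inv i)};
  chart_transition_smooth : forall i j (c : 'I_n),
    smooth_on (chart_map i @` (chart_dom i `&` chart_dom j))
              (fun x => chart_map j (chart_inv i x) 0 c)
}.

Section Flow.
Context {R : realType} {n : nat} {M : topologicalType}.
Variables (A : smooth_atlas R n M) (T : R).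

Definition chart_image (i : chart A) : set 'rV[R]_n :=
  chart_map i @` chart_dom i.

(* [g i t x] is the matrix of g(t) in the chart [i] at the point with
   coordinates [x]. *)
Implicit Types (g : chart A -> R -> 'rV[R]_n -> 'M[R]_n) (f : R -> M -> R).

Definition transition_jacobian (i j : chart A) (x : 'rV[R]_n) (c a : 'I_n) : R :=
  pderiv a (fun y => chart_map j (chart_inv i y) 0 c) x.

Record smooth_metric_family g : Prop := SmoothMetricFamily {
  metric_symmetric : forall i (t : R) x, 0 <= t <= T -> chart_image i x ->
    (g i t x)^T = g i t x;
  metric_posdef : forall i (t : R) x, 0 <= t <= T -> chart_image i x ->
    forall v : 'rV[R]_n, v != 0 -> 0 < (v *m g i t x *m v^T) 0 0;
  metric_smooth : forall i a b,
    smooth_spacetime T (chart_image i) (fun t x => g i t x a b);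
  metric_transition : forall i j (t : R) p, 0 <= t <= T ->
    chart_dom i p -> chart_dom j p -> forall a b,
    g i t (chart_map i p) a b =
      \sum_c \sum_d
        transition_jacobian i j (chart_map i p) c a *
        transition_jacobian i j (chart_map i p) d b *
        g j t (chart_map j p) c d
}.

Definition ricci_flow g : Prop :=
  smooth_metric_family g /\
  forall i (t : R) x, 0 <= t <= T -> chart_image i x -> forall a b,
    tderiv T (fun s y => g i s y a b) t x = - 2 * ricci (g i t) a b x.

Definition nonneg_scalar_curvature g : Prop :=
  forall i (t : R) x, 0 <= t <= T -> chart_image i x ->
    0 <= scalar_curvature (g i t) x.

Definition in_chart (i : chart A) f (t : R) (x : 'rV[R]_n) : R :=
  f t (chart_inv i x).

Definition smooth_function f : Prop :=
  forall i, smooth_spacetime T (chart_image i) (in_chart i f).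

Definition conjugate_heat_solution g f : Prop :=
  smooth_function f /\
  forall i (t : R) x, 0 <= t <= T -> chart_image i x ->
    tderiv T (in_chart i f) t x =
      - laplacian (g i t) (in_chart i f t) x
      + scalar_curvature (g i t) x * in_chart i f t x.

(* H, computed at the point [p] in the chart [i]. *)
Definition harnack_H g f (i : chart A) (t : R) (p : M) : R :=
  let u := in_chart i (fun s q => - ln (f s q)) t in
  let x := chart_map i p in
  2 * laplacian (g i t) u x - grad_sqnorm (g i t) u x
  + scalar_curvature (g i t) x - 2 * (n%:R / (T - t)).

End Flow.

(* Main.v *)
Require Import Defs.
From HB Require Import structures.
From mathcomp Require Import all_boot all_order all_algebra.
From mathcomp Require Import all_classical all_reals all_analysis.
From mathcomp Require Import ring lra.

Set Implicit Arguments.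
Unset Strict Implicit.
Unset Printing Implicit Defensive.

Import Order.TTheory GRing.Theory Num.Theory.
Import numFieldNormedType.Exports.
Local Open Scope classical_set_scope.
Local Open Scope ring_scope.

(** Put P = 2 Delta u - |nabla u|^2 + R, so that H = P - 2 n / (T - t).  The
heat equation for f says u_t = - Delta u + |nabla u|^2 - R.  Along the Ricci
flow, the Bochner formula, the contracted Bianchi identity and the evolution
of the connection combine into the exact identity [dt_harnack]
<<
  dP/dt = - Delta P + 2 <nabla u, nabla P> + 2 |S|^2,   S = Ric + Hess u.
>>
This is a backward heat equation, so (T - t) P is examined at a point where it
is maximal on the compact space [0, T] x M, and it may be assumed that P > 0
and t < T there.  At that point nabla P = 0 and Delta P <= 0, and the right
time derivative of (T - t) P is at most 0, hence
P >= (T - t) dP/dt >= 2 (T - t) |S|^2 >= (2 (T - t) / n) (tr S)^2.  Moreover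
2 tr S = P + |nabla u|^2 + R >= P because R >= 0.  Together these give
(T - t) P <= 2 n at the maximum, hence everywhere, and this is H <= 0
([chart_max], [scaled_harnack_bound]).

Two devices keep the proof within local coordinates.

The tensor identities are proved in an arbitrary commutative ring with
commuting derivations, [None] standing for the time derivative and [Some a]
for the a-th partial derivative: no analysis enters, and every identity is
one between matrices over the ring.  They are transported to functions by
taking for the ring the smooth functions on a slab [0, T] x V; the only
analytic input is that mixed partial derivatives commute on the slab, up to
its two ends ([pd_comm]).

The maximum is taken over M, so P must not depend on the chart.  The
transformation rule of the curvature, which involves second derivatives of
the transition maps, is never computed.  Under the flow Ric = - (1/2) dg/dt,
and g transforms by a Jacobian that does not depend on time, so Ric is a
tensor; and by the equation for u, P = - 2 u_t + |nabla u|^2 - R, which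
contains only first derivatives of u ([harnack_transition]). *)

(** * Riemannian geometry over a commutative ring with derivations *)

(** Closes an identity between matrices that becomes linear once the products
are expanded.  Transposes, images under derivations and products become
opaque matrices, so that only entries of single matrices, which commute, are
left to [ring]. *)
Ltac mx_abel :=
  repeat match goal with |- context [@trmx ?R ?m ?n ?X] =>
    let M := fresh "M" in set M := (@trmx R m n X); clearbody M end;
  repeat match goal with |- context [@map_mx ?R ?S ?f ?m ?n ?X] =>
    let M := fresh "M" in set M := (@map_mx R S f m n X); clearbody M end;
  rewrite ?(mulmxDl, mulmxDr, mulNmx, mulmxN) ?opprD ?opprK ?mulmxA;
  repeat match goal with |- context [@mulmx ?R ?m ?n ?p ?X ?Y] =>
    let M := fresh "M" in set M := (@mulmx R m n p X Y); clearbody M end;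
  apply/matrixP=> ? ?; rewrite !mxE; ring.

Section DifferentialRing.
Variables (A : comPzRingType) (n : nat) (D : option 'I_n -> A -> A) (half : A).
Hypothesis half2 : half * 2 = 1.
Hypothesis derD : forall o x y, D o (x + y) = D o x + D o y.
Hypothesis derM : forall o x y, D o (x * y) = D o x * y + x * D o y.
Hypothesis derC : forall o p x, D o (D p x) = D p (D o x).

Local Notation dx i := (D (Some i)).

Lemma der0 o : D o 0 = 0.
Proof. by apply: (@addrI _ (D o 0)); rewrite -derD !addr0. Qed.

Lemma derN o x : D o (- x) = - D o x.
Proof. by apply/eqP; rewrite -addr_eq0 -derD addNr der0. Qed.

Lemma der1 o : D o 1 = 0.
Proof.
by apply: (@addrI _ (D o 1)); rewrite addr0 -{3}(mulr1 1) derM mulr1 mul1r.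
Qed.

Lemma der2 o : D o 2 = 0.
Proof. by rewrite -[2]/(1 + 1) derD der1 addr0. Qed.

Lemma der2M o x : D o (2 * x) = 2 * D o x.
Proof. by rewrite derM der2 mul0r add0r. Qed.

Lemma der_half o : D o half = 0.
Proof.
have : D o (half * 2) * half = 0 by rewrite half2 der1 mul0r.
by rewrite derM der2 mulr0 addr0 -mulrA [2 * _]mulrC half2 mulr1.
Qed.

Lemma der_sum o (J : finType) (F : J -> A) :
  D o (\sum_j F j) = \sum_j D o (F j).
Proof. exact: (big_morph _ (derD o) (der0 o)). Qed.

Lemma double_inj (x y : A) : 2 * x = 2 * y -> x = y.
Proof. by move=> /(congr1 ( *%R half)); rewrite !mulrA half2 !mul1r. Qed.

Lemma addr_self_inj (x y : A) : x + x = y + y -> x = y.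
Proof. by move=> E; apply: double_inj; rewrite -[2]/(1 + 1) !mulrDl !mul1r. Qed.

Definition dmx o p q (M : 'M[A]_(p, q)) : 'M[A]_(p, q) := map_mx (D o) M.

Lemma dmxD o p q (M N : 'M[A]_(p, q)) : dmx o (M + N) = dmx o M + dmx o N.
Proof. by apply/matrixP=> i j; rewrite !mxE derD. Qed.

Lemma dmxN o p q (M : 'M[A]_(p, q)) : dmx o (- M) = - dmx o M.
Proof. by apply/matrixP=> i j; rewrite !mxE derN. Qed.

Lemma dmxM o p q r (M : 'M[A]_(p, q)) (N : 'M[A]_(q, r)) :
  dmx o (M *m N) = dmx o M *m N + M *m dmx o N.
Proof.
apply/matrixP=> i j; rewrite !mxE der_sum -big_split /=.
by apply: eq_bigr => k _; rewrite !mxE derM.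
Qed.

Lemma dmxC o o' p q (M : 'M[A]_(p, q)) : dmx o (dmx o' M) = dmx o' (dmx o M).
Proof. by apply/matrixP=> i j; rewrite !mxE derC. Qed.

Lemma mx_trD p q (M N : 'M[A]_(p, q)) : (M + N)^T = M^T + N^T.
Proof. by apply/matrixP=> i j; rewrite !mxE. Qed.

Lemma mx_trN p q (M : 'M[A]_(p, q)) : (- M)^T = - M^T.
Proof. by apply/matrixP=> i j; rewrite !mxE. Qed.

Lemma dmx_tr o p q (M : 'M[A]_(p, q)) : dmx o M^T = (dmx o M)^T.
Proof. by apply/matrixP=> i j; rewrite !mxE. Qed.

Lemma dmx_trace o (M : 'M[A]_n) : D o (\tr M) = \tr (dmx o M).
Proof. by rewrite /mxtrace der_sum; apply: eq_bigr => i _; rewrite mxE. Qed.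

Lemma dmx1 o p : dmx o (1%:M : 'M[A]_p) = 0.
Proof.
apply/matrixP=> i j; rewrite !mxE.
by case: (i == j); rewrite ?der1 ?der0.
Qed.

Variables (G K : 'M[A]_n).

(** [G] stands for the matrix of the metric and [K] for its inverse.  The
formulas below are the coordinate expressions of the Levi-Civita connection
and of its curvature and operators. *)
Definition chris k i j : A :=
  half * \sum_l K k l * (dx i (G j l) + dx j (G i l) - dx l (G i j)).

Definition riem l i j k : A :=
  dx i (chris l j k) - dx j (chris l i k)
  + \sum_m (chris l i m * chris m j k - chris l j m * chris m i k).

Definition ric j k : A := \sum_i riem i i j k.

Definition scal : A := \sum_i \sum_j K i j * ric i j.

Definition hess u i j : A := dx i (dx j u) - \sum_k chris k i j * dx k u.

Definition lap u : A := \sum_i \sum_j K i j * hess u i j.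

Definition grad2 u : A := \sum_i \sum_j K i j * dx i u * dx j u.

Hypothesis Gsym : G^T = G.
Hypothesis Ksym : K^T = K.
Hypothesis GK : G *m K = 1%:M.
Hypothesis KG : K *m G = 1%:M.

(** The matrix forms.  [Gam i] is the matrix of the connection in the direction
i, so that [D (Some i) + Gam i] differentiates vector fields covariantly, and
[Rm i j] is the commutator of two of these operators. *)
Definition Gam i : 'M[A]_n := \matrix_(k, j) chris k i j.
Definition Rm i j : 'M[A]_n :=
  dmx (Some i) (Gam j) - dmx (Some j) (Gam i) + Gam i *m Gam j - Gam j *m Gam i.
Definition Ric : 'M[A]_n := \matrix_(j, k) ric j k.
Definition Hess u : 'M[A]_n := \matrix_(i, j) hess u i j.
Definition du u : 'cV[A]_n := \col_i dx i u.
Definition grad u : 'cV[A]_n := K *m du u.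
Definition divg (v : 'cV[A]_n) : A :=
  \sum_i (dmx (Some i) v + Gam i *m v) i 0.

Lemma Gsym_ i j : G i j = G j i.
Proof. by rewrite -{1}Gsym mxE. Qed.

Lemma Ksym_ i j : K i j = K j i.
Proof. by rewrite -{1}Ksym mxE. Qed.

Lemma chris_sym k i j : chris k i j = chris k j i.
Proof.
congr (_ * _); apply: eq_bigr => l _; rewrite (Gsym_ i j).
by rewrite [X in _ * (X - _)]addrC.
Qed.

Lemma riemE l i j k : riem l i j k = Rm i j l k.
Proof.
rewrite /riem /Rm !mxE -!addrA; congr (_ + (_ + _)).
rewrite sumrB; congr (_ - _); apply: eq_bigr => m _; rewrite !mxE //.
Qed.

Lemma ricE j k : Ric j k = \sum_i Rm i j i k.
Proof. by rewrite mxE; apply: eq_bigr => i _; rewrite riemE. Qed.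

Lemma trace_contract (M : 'M[A]_n) : \tr (K *m M) = \sum_i \sum_j K i j * M i j.
Proof.
rewrite exchange_big; apply: eq_bigr => i _; rewrite mxE.
by apply: eq_bigr => j _; rewrite Ksym_.
Qed.

Lemma scalE : scal = \tr (K *m Ric).
Proof.
by rewrite trace_contract; apply: eq_bigr => i _; apply: eq_bigr => j _; rewrite mxE.
Qed.

Lemma lapE u : lap u = \tr (K *m Hess u).
Proof.
by rewrite trace_contract; apply: eq_bigr => i _; apply: eq_bigr => j _; rewrite mxE.
Qed.

Lemma Hess_sym u : (Hess u)^T = Hess u.
Proof.
apply/matrixP=> i j; rewrite !mxE /hess derC; congr (_ - _).
by apply: eq_bigr => k _; rewrite chris_sym.
Qed.

Lemma lower_chris i p j :
  (G *m Gam i) p j = half * (dx i (G j p) + dx j (G i p) - dx p (G i j)).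
Proof.
rewrite mxE.
under eq_bigr => k _ do rewrite mxE /chris mulrCA mulr_sumr.
rewrite -mulr_sumr exchange_big /=; congr (_ * _).
under eq_bigr => l _ do under eq_bigr => k _ do rewrite mulrA.
under eq_bigr => l _ do rewrite -mulr_suml.
have GKE l : \sum_k G p k * K k l = (p == l)%:R.
  by have /matrixP/(_ p l) := GK; rewrite !mxE.
under eq_bigr => l _ do rewrite GKE.
rewrite (bigD1 p) //= eqxx mul1r [X in _ + X]big1 ?addr0 // => l lp.
by rewrite eq_sym (negPf lp) mul0r.
Qed.

(** The metric is parallel. *)
Lemma metric_compat i : dmx (Some i) G = (Gam i)^T *m G + G *m Gam i.
Proof.
have E : (Gam i)^T *m G = (G *m Gam i)^T by rewrite trmx_mul Gsym.
apply/matrixP=> p j; rewrite E [RHS]mxE [X in X + _]mxE !lower_chris mxE.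
rewrite (Gsym_ j p) (Gsym_ i j) (Gsym_ i p) -mulrDr.
apply: double_inj; rewrite mulrA [2 * half]mulrC half2; ring.
Qed.

Lemma der_inverse o : dmx o K = - (K *m dmx o G *m K).
Proof.
have : dmx o (K *m G) *m K = 0 by rewrite KG dmx1 mul0mx.
rewrite dmxM mulmxDl -mulmxA GK mulmx1 => /eqP.
by rewrite addr_eq0 => /eqP.
Qed.

Lemma der_inverse_metric i : dmx (Some i) K = - (K *m (Gam i)^T) - Gam i *m K.
Proof.
rewrite der_inverse metric_compat mulmxDr mulmxDl opprD !mulmxA KG mul1mx.
by rewrite -[_ *m G *m K]mulmxA GK mulmx1.
Qed.

(** The curvature endomorphisms are skew.  The second derivatives of the inverse
metric commute, and the first ones are expressed by the connection, so this
is what commutation says. *)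
Lemma curv_anti i j : (Rm i j *m K)^T = - (Rm i j *m K).
Proof.
have := dmxC (Some i) (Some j) K.
rewrite !der_inverse_metric !dmxD !dmxN !dmxM !dmx_tr !der_inverse_metric => /eqP.
rewrite -subr_eq0 => /eqP E; apply/eqP; rewrite -addr_eq0; apply/eqP.
rewrite -[RHS]oppr0 -E /Rm trmx_mul Ksym.
rewrite !(mx_trD, mx_trN) !trmx_mul.
rewrite /dmx; mx_abel.
Qed.

(** The Jacobi identity for the operators [D (Some i) + Gam i].  The lower
indices of [Rm j k] are not corrected by Christoffel symbols, since these
corrections cancel in the cyclic sum. *)
Lemma second_bianchi i j k :
  dmx (Some i) (Rm j k) + Gam i *m Rm j k - Rm j k *m Gam i
  + (dmx (Some j) (Rm k i) + Gam j *m Rm k i - Rm k i *m Gam j)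
  + (dmx (Some k) (Rm i j) + Gam k *m Rm i j - Rm i j *m Gam k) = 0.
Proof.
rewrite /Rm !dmxD !dmxN !dmxM.
rewrite (dmxC (Some j) (Some i)) (dmxC (Some k) (Some i)).
rewrite (dmxC (Some k) (Some j)).
rewrite /dmx; mx_abel.
Qed.

Lemma Rm_anti i j : Rm j i = - Rm i j.
Proof. rewrite /Rm; mx_abel. Qed.

Lemma divgN v : divg (- v) = - divg v.
Proof.
rewrite /divg -sumrN; apply: eq_bigr => i _.
by rewrite dmxN mulmxN -opprD mxE.
Qed.

(** Differentiating in the direction of the upper index that is then contracted
with it produces a divergence. *)
Lemma contract_divg (X : 'I_n -> 'M[A]_n) :
  \sum_i \sum_j (dmx (Some i) (X j) + Gam i *m X j) i j
  = divg (\col_i \sum_j X j i j).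
Proof.
apply: eq_bigr => i _; rewrite !mxE der_sum.
under eq_bigr do rewrite !mxE.
rewrite big_split /=; congr (_ + _).
by rewrite exchange_big; apply: eq_bigr => m _; rewrite !mxE mulr_sumr.
Qed.

(* Under the Ricci flow the symmetry of Ric is inherited from that of g, hence
   it need not be derived from the symmetries of the curvature. *)
Hypothesis Ric_sym : Ric^T = Ric.

(** Raising the last lower index of the curvature makes skewness the plain
identity [Rup_anti], with no metric in it. *)
Definition Rup i j : 'M[A]_n := Rm i j *m K.

Lemma Rup_contract k p : \sum_i Rup i k i p = (K *m Ric) p k.
Proof.
have -> : (K *m Ric) p k = (Ric *m K) k p.
  have -> : K *m Ric = (Ric *m K)^T by rewrite trmx_mul Ksym Ric_sym.
  by rewrite mxE.
rewrite mxE; under eq_bigr => i _ do rewrite mxE.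
rewrite exchange_big; apply: eq_bigr => l _.
by rewrite ricE mulr_suml.
Qed.

Lemma Rup_anti i j a b : Rup i j a b = - Rup i j b a.
Proof. by have /matrixP/(_ b a) := curv_anti i j; rewrite mxE [RHS]mxE. Qed.

Lemma Rup_swap i j : Rup j i = - Rup i j.
Proof. by rewrite /Rup Rm_anti mulNmx. Qed.

Lemma Rup_contract_r k p : \sum_i Rup k i p i = (K *m Ric) p k.
Proof.
rewrite -Rup_contract; apply: eq_bigr => i _.
by rewrite Rup_swap mxE [in RHS]Rup_anti.
Qed.

(** The covariant derivative in the two matrix indices only, both of them
upper: the indices labelling the plane of [Rup] are left alone, as in
[second_bianchi]. *)
Definition cov_up i (X : 'M[A]_n) : 'M[A]_n :=
  dmx (Some i) X + Gam i *m X + X *m (Gam i)^T.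

Lemma cov_upN i X : cov_up i (- X) = - cov_up i X.
Proof. rewrite /cov_up dmxN; mx_abel. Qed.

Lemma cov_Rup i j k : (cov_up i (Rup j k))^T = - cov_up i (Rup j k).
Proof.
move: (curv_anti j k : (Rup j k)^T = - Rup j k); move: (Rup j k) => X E.
rewrite /cov_up !mx_trD !trmx_mul trmxK -dmx_tr E dmxN mulmxN mulNmx.
mx_abel.
Qed.

Lemma second_bianchi_up i j k :
  cov_up i (Rup j k) + cov_up j (Rup k i) + cov_up k (Rup i j) = 0.
Proof.
rewrite /cov_up /Rup !dmxM !der_inverse_metric.
have := congr1 (mulmx^~ K) (second_bianchi i j k); rewrite /= mul0mx => E.
rewrite -[RHS]E; mx_abel.
Qed.

(** Two of the three traces of the second Bianchi identity are divergences of
Ric.  The Christoffel term of the free upper index drops out: it contracts a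
skew pair of indices of the curvature with the symmetric pair of lower indices
of the connection. *)
Lemma bianchi_trace_ricci k :
  \sum_i \sum_j cov_up i (Rup j k) i j = - divg (col k (K *m Ric)).
Proof.
under eq_bigr => i _ do under eq_bigr => j _ do rewrite mxE.
under eq_bigr => i _ do rewrite big_split /=.
rewrite big_split /= contract_divg -divgN.
have -> : \col_i \sum_j Rup j k i j = - col k (K *m Ric).
  apply/matrixP=> i z; rewrite [LHS]mxE [RHS]mxE [in RHS]mxE -Rup_contract.
  by rewrite -sumrN; apply: eq_bigr => j _; rewrite Rup_anti.
rewrite [X in _ + X = _](_ : _ = 0) ?addr0 //.
set S := LHS.
suff : S = - S.
  move=> SN; apply: double_inj.
  by rewrite mulr0 -[2]/(1 + 1) mulrDl mul1r {2}SN addrN.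
have -> : S = \sum_j \sum_i \sum_m Rup j k i m * chris j i m.
  rewrite /S exchange_big; apply: eq_bigr => j _; apply: eq_bigr => i _.
  by rewrite mxE; apply: eq_bigr => m _; rewrite !mxE.
rewrite -sumrN; apply: eq_bigr => j _.
rewrite [LHS]exchange_big -sumrN; apply: eq_bigr => i _.
rewrite -sumrN; apply: eq_bigr => m _.
by rewrite Rup_anti chris_sym mulNr.
Qed.

(** The third trace is the derivative of the scalar curvature.  Its Christoffel
term is twice the correction in the lower index of the divergence of Ric,
which makes the identity tensorial when the three traces are added. *)
Lemma bianchi_trace_scal k :
  \sum_i \sum_j cov_up k (Rup i j) i j
  = dx k scal + 2 * \tr (Gam k *m (K *m Ric)).
Proof.
under eq_bigr => i _ do under eq_bigr => j _ do rewrite mxE [X in X + _]mxE.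
under eq_bigr => i _ do rewrite big_split /= big_split /=.
rewrite !big_split /= -addrA; congr (_ + _).
  rewrite scalE /mxtrace der_sum exchange_big; apply: eq_bigr => j _.
  by rewrite -Rup_contract der_sum; apply: eq_bigr => i _; rewrite mxE.
rewrite -[2]/(1 + 1) mulrDl mul1r; congr (_ + _).
  apply: eq_bigr => i _; rewrite mxE.
  under eq_bigr => j _ do rewrite mxE.
  rewrite exchange_big; apply: eq_bigr => m _.
  by rewrite -Rup_contract_r mulr_sumr.
rewrite exchange_big; apply: eq_bigr => j _; rewrite mxE.
under eq_bigr => i _ do rewrite mxE.
rewrite exchange_big; apply: eq_bigr => m _.
rewrite -Rup_contract mulr_sumr; apply: eq_bigr => i _.
by rewrite mulrC !mxE.
Qed.

(** The right-hand side is twice the covariant divergence of Ric as a mixed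
tensor: the trace subtracted is the correction in the lower index k. *)
Lemma contracted_bianchi k :
  dx k scal = 2 * (divg (col k (K *m Ric)) - \tr (Gam k *m (K *m Ric))).
Proof.
have E : \sum_i \sum_j cov_up i (Rup j k) i j + \sum_i \sum_j cov_up j (Rup k i) i j
         + \sum_i \sum_j cov_up k (Rup i j) i j = 0.
  rewrite -!big_split /= big1 // => i _; rewrite -!big_split /= big1 // => j _.
  have /matrixP/(_ i j) := second_bianchi_up i j k.
  by rewrite mxE [X in X + _]mxE [RHS]mxE.
have F : \sum_i \sum_j cov_up j (Rup k i) i j = \sum_i \sum_j cov_up i (Rup j k) i j.
  rewrite exchange_big; apply: eq_bigr => i _; apply: eq_bigr => j _.
  have /matrixP/(_ j i) := cov_Rup i j k; rewrite mxE => ->.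
  by rewrite (Rup_swap j k) cov_upN.
move: E; rewrite F bianchi_trace_ricci bianchi_trace_scal.
move: (divg _) (\tr _) (dx k scal) => a b c /eqP; rewrite addr_eq0 => /eqP E.
have Ec : c + 2 * b = a + a by rewrite -[LHS]opprK -E; ring.
by rewrite -[c](addrK (2 * b)) Ec; ring.
Qed.

Lemma divgD v w : divg (v + w) = divg v + divg w.
Proof.
rewrite /divg -big_split; apply: eq_bigr => i _.
by rewrite dmxD mulmxDr addrACA mxE.
Qed.

Lemma divg0 : divg 0 = 0.
Proof.
by rewrite -[0 in LHS](subrr 0) divgD divgN addrN.
Qed.

Lemma contract_divg_tr (X : 'I_n -> 'M[A]_n) :
  \sum_i \sum_j (dmx (Some j) (X i) + X i *m (Gam j)^T) i j
  = divg (\col_j \sum_i X i i j).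
Proof.
have -> : (\col_j \sum_i X i i j) = \col_j \sum_i (X i)^T j i.
  by apply/colP=> j; rewrite !mxE; apply: eq_bigr => i _; rewrite mxE.
rewrite -contract_divg exchange_big; apply: eq_bigr => j _.
apply: eq_bigr => i _.
have T (M : 'M[A]_n) : M i j = M^T j i by rewrite mxE.
by rewrite T mx_trD trmx_mul dmx_tr !trmxK.
Qed.

Lemma cov_grad i u : dmx (Some i) (grad u) + Gam i *m grad u = K *m col i (Hess u).
Proof.
have -> : col i (Hess u) = dmx (Some i) (du u) - (Gam i)^T *m du u.
  apply/colP=> l; rewrite !mxE /hess derC; congr (_ - _).
  by apply: eq_bigr => k _; rewrite !mxE chris_sym.
rewrite /grad dmxM der_inverse_metric; mx_abel.
Qed.

Lemma lap_divg u : lap u = divg (grad u).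
Proof.
rewrite lapE; apply: eq_bigr => i _; rewrite cov_grad !mxE.
by apply: eq_bigr => k _; rewrite !mxE.
Qed.

(** Commuting the covariant derivatives of the gradient field costs a curvature
term, whose trace is Ric(grad u). *)
Lemma ricci_identity u l :
  divg (col l (K *m Hess u))
  = \tr (Gam l *m (K *m Hess u)) + dx l (lap u) + (Ric *m grad u) l 0.
Proof.
pose B i := dmx (Some i) (grad u) + Gam i *m grad u.
have BE i : col i (K *m Hess u) = B i.
  by rewrite /B cov_grad; apply/colP=> k; rewrite !mxE; apply: eq_bigr => m _; rewrite !mxE.
have comm k : dmx (Some k) (B l) + Gam k *m B l
   = dmx (Some l) (B k) + Gam l *m B k + Rm k l *m grad u.
  rewrite /B; move: (grad u) => X.
  rewrite /Rm !dmxD !dmxM (dmxC (Some k) (Some l)); mx_abel.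
rewrite BE /divg.
under eq_bigr => k _ do rewrite comm mxE [X in X + _]mxE.
rewrite !big_split /= [X in X + _ = _]addrC; congr (_ + _ + _).
- apply: eq_bigr => k _; rewrite -BE mxE [RHS]mxE.
  by apply: eq_bigr => m _; rewrite [col _ _ _ _]mxE.
- rewrite lapE dmx_trace; apply: eq_bigr => k _.
  by rewrite -BE !mxE.
- rewrite mxE; under eq_bigr => k _ do rewrite mxE.
  rewrite exchange_big; apply: eq_bigr => m _.
  by rewrite ricE mulr_suml.
Qed.

Definition pairing u v : A := \sum_l grad u l 0 * dx l v.

Lemma grad2E u : grad2 u = pairing u u.
Proof.
rewrite /grad2 exchange_big; apply: eq_bigr => l _.
rewrite mxE mulr_suml; apply: eq_bigr => i _.
by rewrite Ksym_ mxE.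
Qed.

Lemma pairingE u v : pairing u v = ((grad u)^T *m du v) 0 0.
Proof. by rewrite mxE; apply: eq_bigr => l _; rewrite !mxE. Qed.

Lemma du_grad2 u : du (grad2 u) = 2 *: (Hess u *m grad u).
Proof.
apply/colP=> i; rewrite mxE grad2E pairingE.
have -> : forall M : 'M[A]_1, dx i (M 0 0) = (dmx (Some i) M) 0 0.
  by move=> M; rewrite mxE.
rewrite dmxM dmx_tr.
have -> : dmx (Some i) (grad u) = K *m col i (Hess u) - Gam i *m grad u.
  by rewrite -cov_grad addrK.
have -> : dmx (Some i) (du u) = col i (Hess u) + (Gam i)^T *m du u.
  apply/colP=> l; rewrite !mxE /hess derC -addrA -[LHS]addr0; congr (_ + _).
  rewrite addrC; apply/esym/eqP; rewrite subr_eq0; apply/eqP.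
  by apply: eq_bigr => k _; rewrite !mxE chris_sym.
have H1 : (K *m col i (Hess u))^T *m du u = (col i (Hess u))^T *m grad u.
  by rewrite trmx_mul Ksym mulmxA.
have H2 : (grad u)^T *m col i (Hess u) = (col i (Hess u))^T *m grad u.
  by apply/matrixP=> a b; rewrite !mxE; apply: eq_bigr => k _; rewrite !mxE (ord1 a) (ord1 b) mulrC.
rewrite mx_trD mx_trN mulmxDl mulmxDr mulNmx H1 H2 (trmx_mul (Gam i)) mulmxA.
rewrite addrACA addNr addr0.
rewrite !mxE -[2]/(1 + 1) mulrDl mul1r; congr (_ + _);
  apply: eq_bigr => k _; rewrite !mxE; congr (_ * _);
  have /matrixP/(_ i k) := Hess_sym u; by rewrite !mxE.
Qed.

Definition ricgrad u : A := \sum_l grad u l 0 * (Ric *m grad u) l 0.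

(** The Leibniz rule for the divergence of an endomorphism applied to a vector
field: the Christoffel corrections in the contracted index cancel by the
symmetry of the connection. *)
Lemma divg_mul (B : 'M[A]_n) (X : 'cV[A]_n) :
  divg (B *m X) = \sum_l X l 0 * (divg (col l B) - \tr (Gam l *m B))
    + \sum_k (B *m (dmx (Some k) X + Gam k *m X)) k 0.
Proof.
have -> : divg (B *m X) = \sum_k ((dmx (Some k) B + Gam k *m B) *m X) k 0
    + \sum_k (B *m dmx (Some k) X) k 0.
  rewrite /divg -big_split; apply: eq_bigr => k _.
  by rewrite dmxM mulmxDl mulmxA addrAC mxE.
have -> : \sum_k ((dmx (Some k) B + Gam k *m B) *m X) k 0
    = \sum_l X l 0 * divg (col l B).
  under eq_bigr => k _ do rewrite mxE.
  rewrite exchange_big; apply: eq_bigr => l _; rewrite -mulr_suml mulrC.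
  congr (_ * _); apply: eq_bigr => k _; rewrite !mxE; congr (_ + _).
  by apply: eq_bigr => m _; rewrite !mxE.
have -> : \sum_k (B *m (dmx (Some k) X + Gam k *m X)) k 0
   = \sum_k (B *m dmx (Some k) X) k 0 + \sum_k (B *m (Gam k *m X)) k 0.
  by rewrite -big_split; apply: eq_bigr => k _; rewrite mulmxDr mxE.
have -> : \sum_k (B *m (Gam k *m X)) k 0 = \sum_l X l 0 * \tr (Gam l *m B).
  have -> : \sum_k (B *m (Gam k *m X)) k 0
    = \sum_k \sum_l \sum_m X m 0 * (chris l k m * B k l).
    apply: eq_bigr => k _; rewrite mxE; apply: eq_bigr => l _.
    by rewrite mxE mulr_sumr; apply: eq_bigr => m _; rewrite mxE; ring.
  under eq_bigr => k _ do rewrite exchange_big.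
  rewrite exchange_big; apply: eq_bigr => m _; rewrite mulr_sumr exchange_big.
  apply: eq_bigr => l _; rewrite mxE mulr_sumr; apply: eq_bigr => k _.
  by rewrite mxE chris_sym.
under [X in _ = X + _]eq_bigr => l _ do rewrite mulrBr.
rewrite sumrB; ring.
Qed.

(** The gradient of |nabla u|^2 is 2 Hess u (grad u), so the Laplacian is the
divergence of this field: [divg_mul] splits it into |Hess u|^2 and the
divergence of Hess u, which [ricci_identity] evaluates. *)
Lemma bochner u :
  lap (grad2 u) = 2 * (\tr (K *m Hess u *m (K *m Hess u))
                       + pairing u (lap u) + ricgrad u).
Proof.
have dvg2 v : divg (2 *: v) = 2 * divg v.
  have -> : 2 *: v = v + v by apply/colP=> i; rewrite !mxE; ring.
  by rewrite divgD; ring.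
rewrite lap_divg [grad (grad2 _)]/grad du_grad2 -scalemxAr dvg2.
rewrite (mulmxA K (Hess u)) divg_mul; congr (_ * _).
rewrite addrC -addrA; congr (_ + _).
  apply: eq_bigr => k _; rewrite cov_grad !mulmxA.
  by rewrite mxE [RHS]mxE; apply: eq_bigr => l _; rewrite !mxE.
rewrite /pairing /ricgrad -big_split; apply: eq_bigr => l _ /=.
by rewrite ricci_identity; ring.
Qed.

(** * Evolution equations under the Ricci flow *)

Section RicciFlow.
Local Notation dt := (D None).
Hypothesis flow : dmx None G = - (Ric + Ric).

Lemma dt_K : dmx None K = K *m Ric *m K + K *m Ric *m K.
Proof. rewrite der_inverse flow; mx_abel. Qed.

(** The trace of the connection is half the logarithmic derivative of det g. *)
Lemma tr_Gam i : \tr (Gam i) + \tr (Gam i) = \tr (K *m dmx (Some i) G).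
Proof.
rewrite metric_compat mulmxDr mxtraceD (mulmxA K G) KG mul1mx; congr (_ + _).
by rewrite mxtrace_mulC -mulmxA GK mulmx1 mxtrace_tr.
Qed.

(** The logarithmic derivative of det g in time is - 2 R, and the derivatives
in space and time commute. *)
Lemma dt_tr_Gam i : \tr (dmx None (Gam i)) = - dx i scal.
Proof.
apply: double_inj; rewrite -[2]/(1 + 1) !mulrDl !mul1r.
rewrite -dmx_trace -derD tr_Gam dmx_trace dmxM dt_K (dmxC None) flow.
rewrite dmxN dmxD scalE dmx_trace dmxM der_inverse.
rewrite mulmxDl mulmxN mulmxDr !mulNmx !(mxtraceD, raddfN) /=.
have -> : \tr (K *m Ric *m K *m dmx (Some i) G)
        = \tr (K *m dmx (Some i) G *m K *m Ric).
  by rewrite -mulmxA mxtrace_mulC !mulmxA.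
ring.
Qed.

(** The contracted Bianchi identity in the form in which the partial
derivatives of Ric with lower indices occur in the variation of the
connection. *)
Lemma bianchi_low p :
  \tr (K *m dmx (Some p) Ric) =
  2 * \sum_i (K *m dmx (Some i) Ric - K *m (Gam i)^T *m Ric) i p.
Proof.
have E : \tr (K *m dmx (Some p) Ric)
   = dx p scal + 2 * \tr (Gam p *m (K *m Ric)).
  rewrite scalE dmx_trace dmxM der_inverse_metric mulmxDl !mulNmx !(mxtraceD, raddfN) /=.
  have -> : \tr (K *m (Gam p)^T *m Ric) = \tr (Gam p *m (K *m Ric)).
    rewrite -mxtrace_tr !trmx_mul trmxK Ksym Ric_sym mulmxA.
    by rewrite -mulmxA mxtrace_mulC mulmxA.
  rewrite mulmxA; ring.
rewrite E contracted_bianchi mulrBr addrNK; congr (_ * _).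
apply: eq_bigr => i _.
have -> : dmx (Some i) (col p (K *m Ric)) + Gam i *m col p (K *m Ric)
  = col p (dmx (Some i) (K *m Ric) + Gam i *m (K *m Ric)).
  apply/colP=> k; rewrite !mxE; congr (_ + _).
  by apply: eq_bigr => m _; rewrite !mxE.
rewrite mxE; congr (fun_of_matrix _ _ _).
rewrite dmxM der_inverse_metric; mx_abel.
Qed.

Definition dtGam i : 'M[A]_n := dmx None (Gam i).

Lemma lower_dt_chris i p j :
  (G *m dtGam i) p j =
  - (dx i (Ric j p) + dx j (Ric i p) - dx p (Ric i j)) + 2 * (Ric *m Gam i) p j.
Proof.
have E : G *m dtGam i = dmx None (G *m Gam i) + Ric *m Gam i + Ric *m Gam i.
  rewrite dmxM flow mulNmx mulmxDl /dtGam; mx_abel.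
have dtG a b : dt (G a b) = - (2 * Ric a b).
  by have /matrixP/(_ a b) := flow; rewrite !mxE => ->; ring.
rewrite E mxE [X in X + _]mxE [dmx _ _ _ _]mxE lower_chris derM der_half mul0r add0r.
rewrite !derD derN 3!(derC None) !dtG !derN !der2M.
have h x : half * (2 * x) = x by rewrite mulrA half2 mul1r.
rewrite -mulrN -mulrN -!mulrN -!mulrDr h; ring.
Qed.

(** The trace of the variation of the connection over its lower indices is
d R - 2 div Ric up to sign, which vanishes by the contracted Bianchi
identity.  This is why the Laplacian varies only through the inverse
metric. *)
Lemma trace_dtGam_K : \col_k \sum_i (dtGam i *m K) k i = 0.
Proof.
set v := \col_k _.
suff Gv : G *m v = 0 by rewrite -[v]mul1mx -KG -mulmxA Gv mulmx0.
apply/colP=> p; rewrite [RHS]mxE.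
have -> : (G *m v) p 0 = \sum_i (G *m dtGam i *m K) p i.
  rewrite mxE.
  under eq_bigr => k _ do rewrite mxE mulr_sumr.
  rewrite exchange_big; apply: eq_bigr => i _.
  by rewrite -mulmxA [RHS]mxE.
have -> : \sum_i (G *m dtGam i *m K) p i
  = \sum_i \sum_j (dx p (Ric i j) * K j i - dx i (Ric j p) * K j i
      - (dx j (Ric i p) * K j i) + 2 * ((Ric *m Gam i) p j * K j i)).
  apply: eq_bigr => i _; rewrite mxE; apply: eq_bigr => j _.
  rewrite lower_dt_chris; ring.
under eq_bigr => i _ do rewrite big_split /= sumrB sumrB -mulr_sumr.
rewrite big_split /= !sumrB -mulr_sumr.
have S1 : \sum_i \sum_j dx p (Ric i j) * K j i = \tr (K *m dmx (Some p) Ric).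
  rewrite trace_contract; apply: eq_bigr => i _; apply: eq_bigr => j _.
  by rewrite [dmx _ _ _ _]mxE Ksym_ mulrC.
have S2 : \sum_i \sum_j dx i (Ric j p) * K j i
        = \sum_i (K *m dmx (Some i) Ric) i p.
  apply: eq_bigr => i _; rewrite mxE; apply: eq_bigr => j _.
  by rewrite [dmx _ _ _ _]mxE mulrC Ksym_.
have S3 : \sum_i \sum_j dx j (Ric i p) * K j i
        = \sum_i (K *m dmx (Some i) Ric) i p.
  by rewrite -S2 exchange_big; apply: eq_bigr => i _; apply: eq_bigr => j _;
     rewrite Ksym_.
have S4 : \sum_i \sum_j (Ric *m Gam i) p j * K j i
        = \sum_i (K *m (Gam i)^T *m Ric) i p.
  apply: eq_bigr => i _.
  have -> : K *m (Gam i)^T *m Ric = (Ric *m Gam i *m K)^T.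
    by rewrite !trmx_mul Ksym Ric_sym mulmxA.
  by rewrite mxE mxE.
rewrite S1 S2 S3 S4 bianchi_low.
have -> : \sum_i (K *m dmx (Some i) Ric - K *m (Gam i)^T *m Ric) i p
  = \sum_i (K *m dmx (Some i) Ric) i p - \sum_i (K *m (Gam i)^T *m Ric) i p.
  by rewrite -sumrB; apply: eq_bigr => i _; rewrite mxE [X in _ + X]mxE.
ring.
Qed.

(** Palatini's formula: the trace of the variation of Ric is the difference of
two divergences of traces of the variation of the connection.  One of these
traces vanishes by [trace_dtGam_K] and the other one is - d R by
[dt_tr_Gam]. *)
Lemma dt_ric_trace : \tr (K *m dmx None Ric) = lap scal.
Proof.
pose B j := dtGam j *m K.
have dtRm i k : dmx None (Rm i k) *m K
    = cov_up i (B k) - (dmx (Some k) (B i) + B i *m (Gam k)^T) - Gam k *m B i.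
  rewrite /cov_up /B /Rm /dtGam !dmxD !dmxN !dmxM !der_inverse_metric.
  rewrite !(dmxC None (Some _)); mx_abel.
have -> : \tr (K *m dmx None Ric) = \sum_k \sum_i (dmx None (Rm i k) *m K) i k.
  rewrite mxtrace_mulC; apply: eq_bigr => k _.
  rewrite mxE.
  under [RHS]eq_bigr => i _ do rewrite mxE.
  rewrite [RHS]exchange_big; apply: eq_bigr => j _.
  rewrite mxE ricE der_sum mulr_suml.
  by apply: eq_bigr => i _; rewrite [dmx _ _ _ _]mxE.
have -> : \sum_k \sum_i (dmx None (Rm i k) *m K) i k =
    \sum_i \sum_k (dmx (Some i) (B k) + Gam i *m B k) i k
  - \sum_i \sum_k (dmx (Some k) (B i) + B i *m (Gam k)^T) i k
  + (\sum_i \sum_k (B k *m (Gam i)^T) i k - \sum_i \sum_k (Gam k *m B i) i k).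
  rewrite exchange_big -!sumrB -big_split; apply: eq_bigr => i _ /=.
  rewrite -!sumrB -big_split; apply: eq_bigr => k _ /=.
  rewrite dtRm /cov_up !mxE; ring.
rewrite contract_divg contract_divg_tr trace_dtGam_K divg0 sub0r.
have -> : \sum_i \sum_k (Gam k *m B i) i k = \sum_i \sum_k (B k *m (Gam i)^T) i k.
  have -> : \sum_i \sum_k (Gam k *m B i) i k
    = \sum_k \sum_i \sum_m B i m k * chris i k m.
    rewrite exchange_big; apply: eq_bigr => k _; apply: eq_bigr => i _.
    by rewrite mxE; apply: eq_bigr => m _; rewrite mxE mulrC.
  have -> : \sum_i \sum_k (B k *m (Gam i)^T) i k
    = \sum_i \sum_k \sum_m B k i m * chris k i m.
    apply: eq_bigr => i _; apply: eq_bigr => k _.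
    by rewrite mxE; apply: eq_bigr => m _; rewrite [_^T _ _]mxE [Gam _ _ _]mxE.
  rewrite exchange_big [RHS]exchange_big; apply: eq_bigr => i _.
  rewrite exchange_big; apply: eq_bigr => m _; apply: eq_bigr => k _.
  by rewrite chris_sym.
rewrite subrr addr0 lap_divg -divgN; congr (divg _).
apply/colP=> k; rewrite [LHS]mxE [X in - X]mxE [RHS]mxE.
under [X in - X]eq_bigr => i _ do rewrite mxE.
rewrite exchange_big /= -sumrN; apply: eq_bigr => l _.
rewrite -mulr_suml mxE Ksym_ -[RHS]mulrC -mulNr; congr (_ * _).
rewrite -[RHS]opprK -dt_tr_Gam; congr (- _).
apply: eq_bigr => i _; rewrite !mxE; congr (dt _); exact: chris_sym.
Qed.

Lemma dt_scal : dt scal = 2 * \tr (K *m Ric *m (K *m Ric)) + lap scal.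
Proof.
rewrite scalE dmx_trace dmxM dt_K mulmxDl !mxtraceD dt_ric_trace.
by rewrite -!mulmxA -[2]/(1 + 1) mulrDl !mul1r scalE.
Qed.

Lemma dt_lap u :
  dt (lap u) = 2 * \tr (K *m Ric *m (K *m Hess u)) + lap (dt u).
Proof.
rewrite lapE dmx_trace dmxM dt_K mulmxDl !mxtraceD -!mulmxA.
rewrite -[2]/(1 + 1) mulrDl !mul1r; congr (_ + _).
have -> : dmx None (Hess u) = Hess (dt u)
    - \matrix_(i, j) \sum_k dtGam i k j * dx k u.
  apply/matrixP=> i j; rewrite !mxE /hess derD derN !(derC None) der_sum.
  rewrite -addrA -opprD; congr (_ - _).
  rewrite -big_split; apply: eq_bigr => k _.
  by rewrite derM (derC None) addrC !mxE.
rewrite mulmxDr mulmxN mxtraceD -lapE raddfN /= trace_contract.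
rewrite [X in _ - X](_ : _ = 0) ?subr0 //.
have -> : \sum_i \sum_j K i j * (\matrix_(i, j) \sum_k dtGam i k j * dx k u) i j
  = \sum_k (\col_k \sum_i (dtGam i *m K) k i) k 0 * dx k u.
  under [RHS]eq_bigr => k _ do rewrite mxE mulr_suml.
  rewrite [RHS]exchange_big; apply: eq_bigr => i _.
  under [LHS]eq_bigr => j _ do rewrite [X in _ * X]mxE mulr_sumr.
  rewrite [LHS]exchange_big; apply: eq_bigr => k _; rewrite mxE mulr_suml.
  by apply: eq_bigr => j _; rewrite Ksym_; ring.
by rewrite trace_dtGam_K big1 // => k _; rewrite mxE mul0r.
Qed.

Lemma dt_grad2 u : dt (grad2 u) = 2 * ricgrad u + 2 * pairing u (dt u).
Proof.
have E : dmx None ((du u)^T *m K *m du u)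
   = (grad u)^T *m (Ric *m grad u) + (grad u)^T *m (Ric *m grad u)
     + (grad u)^T *m du (dt u) + ((grad u)^T *m du (dt u))^T.
  have duC : dmx None (du u) = du (dt u) by apply/colP=> i; rewrite !mxE derC.
  rewrite !dmxM dt_K dmx_tr duC /grad !trmx_mul !trmxK Ksym; mx_abel.
have /matrixP/(_ 0 0) := E; rewrite mxE.
have <- : grad2 u = ((du u)^T *m K *m du u) 0 0.
  by rewrite grad2E pairingE /grad trmx_mul Ksym.
have -> M N O P : (M + N + O + P^T : 'M[A]_1) 0 0 = M 0 0 + N 0 0 + O 0 0 + P 0 0.
  by rewrite !mxE.
have -> : ((grad u)^T *m (Ric *m grad u)) 0 0 = ricgrad u.
  by rewrite mxE; apply: eq_bigr => l _; rewrite mxE.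
rewrite -pairingE => ->; ring.
Qed.

(** [finv] is the inverse of [f], and the hypothesis on [u] says that u is
- ln f up to a constant, in terms that make sense in the ring. *)
Lemma log_derivatives f finv u : finv * f = 1 ->
  (forall o, D o u = - (finv * D o f)) ->
  lap u = - (finv * lap f) + grad2 u.
Proof.
move=> ff uf.
have dfinv i : dx i finv = - (finv * finv * dx i f).
  have : dx i (finv * f) * finv = 0 by rewrite ff der1 mul0r.
  rewrite derM mulrDl -mulrA [f * finv]mulrC ff mulr1 => /eqP.
  by rewrite addr_eq0 => /eqP ->; congr (- _); ring.
rewrite /lap /grad2 mulr_sumr -sumrN -big_split; apply: eq_bigr => i _ /=.
rewrite mulr_sumr -sumrN -big_split; apply: eq_bigr => j _ /=.
rewrite /hess !uf derN derM dfinv.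
under eq_bigr => k _ do rewrite uf mulrN mulrCA.
by rewrite sumrN -mulr_sumr; ring.
Qed.

Lemma log_conjugate_heat f finv u : finv * f = 1 ->
  (forall o, D o u = - (finv * D o f)) ->
  dt f = - lap f + scal * f -> dt u = - lap u + grad2 u - scal.
Proof.
move=> ff uf hf; rewrite (log_derivatives ff uf) uf hf.
have -> : finv * (- lap f + scal * f) = - (finv * lap f) + scal * (finv * f) by ring.
rewrite ff; ring.
Qed.

(** The quantity P, that is, H without its last term. *)
Definition harnack u := 2 * lap u - grad2 u + scal.

Lemma lapD u v : lap (u + v) = lap u + lap v.
Proof.
rewrite !lap_divg -divgD /grad -mulmxDr; congr (divg (_ *m _)).
by apply/colP=> i; rewrite !mxE derD.
Qed.

Lemma pairingD u v w : pairing u (v + w) = pairing u v + pairing u w.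
Proof. by rewrite -big_split; apply: eq_bigr => i _; rewrite derD mulrDr. Qed.

Lemma lapN u : lap (- u) = - lap u.
Proof.
rewrite !lap_divg -divgN /grad -mulmxN; congr (divg (_ *m _)).
by apply/colP=> i; rewrite !mxE derN.
Qed.

Lemma pairingN u v : pairing u (- v) = - pairing u v.
Proof. by rewrite -sumrN; apply: eq_bigr => i _; rewrite derN mulrN. Qed.

(** The terms Ric(grad u, grad u) from the Bochner formula and from the
variation of |nabla u|^2 cancel.  The variations of R and of the Laplacian
contribute 2 |Ric|^2 + 4 <Ric, Hess u>, and the Bochner formula contributes the
2 |Hess u|^2 that completes the square. *)
Lemma dt_harnack u : dt u = - lap u + grad2 u - scal ->
  dt (harnack u) = - lap (harnack u) + 2 * pairing u (harnack u)
    + 2 * \tr (K *m (Ric + Hess u) *m (K *m (Ric + Hess u))).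
Proof.
move=> ut.
have E : \tr (K *m (Ric + Hess u) *m (K *m (Ric + Hess u)))
  = \tr (K *m Ric *m (K *m Ric)) + 2 * \tr (K *m Ric *m (K *m Hess u))
    + \tr (K *m Hess u *m (K *m Hess u)).
  rewrite !mulmxDr !mulmxDl !mxtraceD (mxtrace_mulC (K *m Hess u) (K *m Ric)).
  ring.
rewrite E /harnack !derD derN der2M dt_lap dt_grad2 dt_scal ut.
rewrite [2 * lap u]mulrDl !mul1r.
rewrite !(lapD, lapN, pairingD, pairingN) bochner; ring.
Qed.
End RicciFlow.
End DifferentialRing.

(** * Positive semidefinite matrices *)

Section PositiveSemidefinite.
Variables (R : rcfType) (n : nat).
Implicit Types (K Q : 'M[R]_n) (v w : 'rV[R]_n).

Definition bform K v w : R := (v *m K *m w^T) 0 0.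

Lemma bformDl K v v' w : bform K (v + v') w = bform K v w + bform K v' w.
Proof. by rewrite /bform !mulmxDl mxE. Qed.

Lemma bformZl K a v w : bform K (a *: v) w = a * bform K v w.
Proof. by rewrite /bform -!scalemxAl mxE. Qed.

Lemma bform_sym K v w : K^T = K -> bform K v w = bform K w v.
Proof.
move=> Ks; rewrite /bform -[in RHS]Ks -[in RHS](trmxK w) -!trmx_mul mulmxA.
by rewrite [RHS]mxE.
Qed.

Lemma bform_delta K i w : bform K (delta_mx 0 i) w = (K *m w^T) i 0.
Proof. by rewrite /bform -mulmxA -rowE mxE. Qed.

(** Symmetric elimination: subtracting from the form the square that completes
its last pivot clears a row and a column and keeps the form semidefinite.
The induction is on the number of rows that may be nonzero. *)
Lemma psd_sum_squares K : K^T = K -> (forall v, 0 <= bform K v v) ->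
  exists2 s : seq 'rV[R]_n, (size s <= n)%N & K = \sum_(w <- s) w^T *m w.
Proof.
have gen m L : (m <= n)%N -> L^T = L -> (forall v, 0 <= bform L v v) ->
    (forall i j : 'I_n, (m <= i)%N -> L i j = 0) ->
    exists2 s : seq 'rV[R]_n, (size s <= m)%N & L = \sum_(w <- s) w^T *m w.
  elim: m L => [|m IH] L mn Ls Lp L0.
    by exists [::] => //; rewrite big_nil; apply/matrixP=> i j; rewrite L0 // mxE.
  pose e := Ordinal mn; pose d : 'rV[R]_n := delta_mx 0 e.
  have dE w : bform L d w = (w *m L) 0 e.
    rewrite bform_delta -[L in LHS]Ls -trmx_mul mxE //.
  have ddE : bform L d d = L e e by rewrite dE -rowE mxE.
  have main v c : 0 <= bform L v v + c * 2 * (v *m L) 0 e + c ^+ 2 * L e e.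
    have := Lp (v + c *: d).
    rewrite bformDl bformZl (bform_sym v _ Ls) (bform_sym d _ Ls) !bformDl.
    rewrite !bformZl (bform_sym v d Ls) dE ddE; set x := bform L v v.
    set y := (v *m L) 0 e; move: x y => x y H.
    apply: le_trans H _; rewrite le_eqVlt; apply/orP; left; apply/eqP; ring.
  have [a0|a0] := eqVneq (L e e) 0.
    have [i j im| s ss Es] := IH L (ltnW mn) Ls Lp; last by exists s => //; apply: leqW.
    move: im; rewrite leq_eqVlt => /orP[/eqP im|im]; last exact: L0.
    have -> : i = e by apply/val_inj.
    pose v : 'rV[R]_n := delta_mx 0 j.
    have vE : (v *m L) 0 e = L e j.
      by rewrite -rowE mxE -[L in LHS]Ls mxE.
    have H c := main v c; move: H; rewrite a0 vE => H.
    (* A zero pivot has a zero row: along [v + c *: d] the form is affine in c,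
       and c below is chosen for it to take the value -1. *)
    apply/eqP/negPn/negP => n0.
    have := H (- (bform L v v + 1) / (2 * L e j)).
    rewrite mulr0 addr0 -mulrA divfK ?mulf_neq0 ?pnatr_eq0 //.
    by rewrite opprD addNKr oppr_ge0 ler10.
  have ap : 0 < L e e by rewrite lt_def a0 -ddE Lp.
  pose w : 'rV[R]_n := (Num.sqrt (L e e))^-1 *: row e L.
  have wwE i j : (w^T *m w) i j = L e i * L e j / L e e.
    rewrite mxE big_ord1 !mxE -[in RHS](sqr_sqrtr (ltW ap)) expr2 invfM; ring.
  have [||i j im|s ss Es] := IH (L - w^T *m w) (ltnW mn).
  - by rewrite linearB /= Ls trmx_mul trmxK.
  - move=> v.
    have -> : bform (L - w^T *m w) v v = bform L v v - ((v *m L) 0 e) ^+ 2 / L e e.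
      rewrite /bform mulmxBr mulmxBl mxE [X in _ + X]mxE; congr (_ - _).
      rewrite mulmxA -mulmxA mxE big_ord1.
      have vw : (v *m w^T) 0 0 = (Num.sqrt (L e e))^-1 * (v *m L) 0 e.
        rewrite /w linearZ /= -scalemxAr mxE; congr (_ * _).
        rewrite !mxE; apply: eq_bigr => k _; rewrite !mxE.
        by rewrite -[L in LHS]Ls mxE.
      have -> : (w *m v^T) 0 0 = (v *m w^T) 0 0.
        by rewrite -[w *m _]trmxK trmx_mul trmxK mxE.
      rewrite vw -[in RHS](sqr_sqrtr (ltW ap)) expr2 [_ ^+ 2 in RHS]expr2 invfM; ring.
    (* The value of c that minimizes the form along [v + c *: d]. *)
    have := main v (- (v *m L) 0 e / L e e).
    set y := (v *m L) 0 e; set x := bform L v v; set a := L e e in a0 *.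
    suff -> : x + - y / a * 2 * y + (- y / a) ^+ 2 * a = x - y ^+ 2 / a by [].
    by field.
  - rewrite mxE [X in _ + X]mxE wwE.
    move: im; rewrite leq_eqVlt => /orP[/eqP im|im].
      have -> : i = e by apply/val_inj.
      by rewrite mulrAC mulfV // mul1r subrr.
    rewrite (L0 i j im) (_ : L e i = 0) ?mul0r ?subrr //.
    by rewrite -[L]Ls mxE L0.
  - by exists (w :: s) => //; rewrite big_cons -Es addrC subrK.
move=> Ks Kp; apply: gen => // i j; by rewrite leqNgt ltn_ord.
Qed.

Lemma trace_sum_squares Q (s : seq 'rV[R]_n) :
  \tr ((\sum_(w <- s) w^T *m w) *m Q) = \sum_(w <- s) bform Q w w.
Proof.
rewrite mulmx_suml raddf_sum; apply: eq_bigr => w _ /=.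
by rewrite -mulmxA mxtrace_mulC /mxtrace big_ord1.
Qed.

(** The trace is the sum of the values of [Q] on the vectors whose squares add
up to [K]. *)
Lemma psd_trace_le0 K Q : K^T = K -> (forall v, 0 <= bform K v v) ->
  (forall v, bform Q v v <= 0) -> \tr (K *m Q) <= 0.
Proof.
move=> Ks Kp Qn; have [s _ ->] := psd_sum_squares Ks Kp.
by rewrite trace_sum_squares; apply: sumr_le0.
Qed.

Lemma cauchy_seq (s : seq 'rV[R]_n) (F : 'rV[R]_n -> R) :
  (\sum_(w <- s) F w) ^+ 2 <= (size s)%:R * \sum_(w <- s) F w ^+ 2.
Proof.
elim: s => [|w s IH]; first by rewrite !big_nil expr0n mulr0.
rewrite !big_cons /= -natr1; set S := \sum_(_ <- _) F _ in IH *.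
set S2 := \sum_(_ <- _) _ in IH *; set k := (size s)%:R in IH *.
have H : 2 * F w * S <= S2 + k * F w ^+ 2.
  rewrite /S /S2 /k mulr_sumr -[size s]sum1_size natr_sum mulr_suml -big_split /=.
  apply: ler_sum => v _; rewrite mul1r -subr_ge0.
  by apply: le_trans (sqr_ge0 (F v - F w)) _; rewrite le_eqVlt; apply/orP; left; apply/eqP; ring.
nra.
Qed.

(** The Cauchy-Schwarz inequality for |Q|^2 >= (tr Q)^2 / n, norm and trace
taken with respect to [K].  When [K] is the sum of the squares of at most n
vectors, the trace of [Q] is the sum of the diagonal entries of the matrix of
[Q] on these vectors, and the squared norm is the sum of the squares of all
its entries. *)
Lemma psd_trace_square K Q : K^T = K -> (forall v, 0 <= bform K v v) ->
  Q^T = Q -> (\tr (K *m Q)) ^+ 2 <= n%:R * \tr (K *m Q *m (K *m Q)).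
Proof.
move=> Ks Kp Qs; have [s sn ->] := psd_sum_squares Ks Kp.
rewrite trace_sum_squares.
have -> : \tr ((\sum_(w <- s) w^T *m w) *m Q *m ((\sum_(w <- s) w^T *m w) *m Q))
   = \sum_(w <- s) \sum_(v <- s) bform Q w v ^+ 2.
  rewrite -mulmxA trace_sum_squares; apply: eq_bigr => w _.
  rewrite /bform mulmx_suml mulmx_sumr mulmx_sumr mulmx_suml summxE.
  apply: eq_bigr => v _.
  have -> : w *m (Q *m (v^T *m v *m Q)) *m w^T = (w *m Q *m v^T) *m (v *m Q *m w^T).
    by rewrite !mulmxA.
  by rewrite mxE big_ord1 -/(bform Q w v) -/(bform Q v w) (bform_sym v w Qs).
apply: le_trans (cauchy_seq _ _) _.
have P : \sum_(w <- s) bform Q w w ^+ 2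
   <= \sum_(w <- s) \sum_(v <- s) bform Q w v ^+ 2.
  rewrite big_seq [leRHS]big_seq; apply: ler_sum => w ws.
  rewrite [leRHS](big_rem w) //= lerDl; apply: sumr_ge0 => v _; exact: sqr_ge0.
apply: ler_pM; rewrite ?ler_nat ?ler0n //.
by apply: sumr_ge0 => w _; exact: sqr_ge0.
Qed.
End PositiveSemidefinite.

(** * Difference quotients along a filter *)

Section DifferenceQuotients.
Context {R : realType} {F : set_system R} {FF : ProperFilter F}.
Variable inc : R -> R.
Hypothesis inc0 : inc s @[s --> F] --> (0 : R).
Hypothesis inc_neq0 : \forall s \near F, inc s != 0.

(** The increment [inc] of the variable is only required to tend to 0 along the
filter without vanishing.  The one-sided time derivatives at the ends of
[0, T] and the partial derivatives in space are both of this form, so that the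
differentiation rules are proved once. *)
Definition quot_cvg (phi : R -> R) (a l : R) :=
  (phi s - a) / inc s @[s --> F] --> l.

Lemma quot_cvg_continuous phi a l : quot_cvg phi a l -> phi s @[s --> F] --> a.
Proof.
move=> H.
have : (phi s - a) / inc s * inc s + a @[s --> F] --> l * 0 + a.
  by apply: cvgD; [apply: cvgM H inc0 | exact: cvg_cst].
rewrite mulr0 add0r; apply: cvg_trans; apply: near_eq_cvg.
by near=> s; rewrite divfK ?subrK //; near: s.
Unshelve. all: by end_near.
Qed.

Lemma quot_cvg_near phi psi a l : (\forall s \near F, phi s = psi s) ->
  quot_cvg phi a l -> quot_cvg psi a l.
Proof.
move=> E; apply: cvg_trans; apply: near_eq_cvg.
by apply: filterS E => s ->.
Qed.

Lemma quot_cvg_cst a : quot_cvg (fun=> a) a 0.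
Proof. by rewrite /quot_cvg subrr; under eq_fun do rewrite mul0r; exact: cvg_cst. Qed.

Lemma quot_cvgD phi psi a b l m : quot_cvg phi a l -> quot_cvg psi b m ->
  quot_cvg (fun s => phi s + psi s) (a + b) (l + m).
Proof.
move=> H1 H2; rewrite /quot_cvg.
rewrite (_ : (fun s => _) = (fun s => (phi s - a) / inc s + (psi s - b) / inc s)).
  exact: cvgD.
by apply/funext => s; rewrite -mulrDl opprD addrACA.
Qed.

Lemma quot_cvgM phi psi a b l m : quot_cvg phi a l -> quot_cvg psi b m ->
  quot_cvg (fun s => phi s * psi s) (a * b) (l * b + a * m).
Proof.
move=> H1 H2; rewrite /quot_cvg.
rewrite (_ : (fun s => _) =
    (fun s => (phi s - a) / inc s * psi s + a * ((psi s - b) / inc s))).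
  apply: cvgD; apply: cvgM => //; [exact: quot_cvg_continuous H2|exact: cvg_cst].
apply/funext => s; ring.
Qed.

(** The difference quotient of [h] at [a], extended by [m] at increment 0, is
continuous there; this avoids dividing by an increment of [phi] that may
vanish. *)
Lemma quot_cvg_comp phi a l (h : R -> R) m : quot_cvg phi a l ->
  is_derive a 1 h m -> quot_cvg (h \o phi) (h a) (m * l).
Proof.
move=> H1 [dh dhE].
pose k y := if y == 0 then m else y^-1 *: (h (y *: 1 + a) - h a).
have kc : k y @[y --> nbhs 0] --> m.
  apply/cvgrPdist_lt => e e0.
  have /cvgrPdist_lt/(_ e e0) : y^-1 *: ((h \o shift a) (y *: 1) - h a) @[y --> 0^'] --> m.
    by rewrite -dhE; exact: dh.
  rewrite near_withinE; apply: filterS => y Hy; rewrite /k.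
  by case: eqP => [_|/eqP/Hy//]; rewrite subrr normr0.
have E s : (h (phi s) - h a) / inc s = k (phi s - a) * ((phi s - a) / inc s).
  rewrite /k subr_eq0; case: eqP => [->|/eqP pa].
    by rewrite !subrr mul0r mulr0.
  rewrite /GRing.scale /= mulr1 subrK -subr_eq0 in pa *.
  by rewrite mulrA [_^-1 * _]mulrC divfK.
rewrite /quot_cvg; under eq_fun do rewrite E.
apply: cvgM => //; apply: cvg_comp kc.
by rewrite -(subrr a); apply: cvgB; [exact: quot_cvg_continuous H1|exact: cvg_cst].
Qed.
End DifferenceQuotients.

(** * Functions of class C^k on [0, T] x V *)

Section SpacetimeCalculus.
Context {R : realType} {n : nat}.
Variables (T : R) (V : set 'rV[R]_n).
Hypothesis T_gt0 : 0 < T.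
Hypothesis V_open : open V.
Implicit Types (F G : R -> 'rV[R]_n -> R) (o : option 'I_n).

Definition slab : set (R * 'rV[R]_n) := [set z | 0 <= z.1 <= T /\ V z.2].

(** Time is the index [None] and the a-th coordinate the index [Some a]. *)
Definition pd o F : R -> 'rV[R]_n -> R :=
  if o is Some a then fun t => pderiv a (F t) else tderiv T F.

Definition pdable o F t x : Prop :=
  if o is Some a then pderivable a (F t) x else tderivable T F t x.

Definition stcont F : Prop :=
  {within slab, continuous (fun z : R * 'rV[R]_n => F z.1 z.2)}.

Lemma CkS k F : Ck_spacetime T V k.+1 F <->
  stcont F /\ forall o, (forall t x, 0 <= t <= T -> V x -> pdable o F t x)
                     /\ Ck_spacetime T V k (pd o F).
Proof.
split=> [[cF [dt kt da]]|[cF H]]; split => //.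
  by case=> [a|]; [exact: da | split].
by split; [exact: (H None).1|exact: (H None).2|move=> a; exact: (H (Some a))].
Qed.

(** The filter, the increment and the moving point that exhibit the partial
derivative of index [o] as a limit of the form [quot_cvg]. *)
Definition pfilter o (t : R) : set_system R :=
  if o is Some _ then 0^' else within [set s | 0 <= s <= T] t^'.
Definition pinc o (t s : R) : R := if o is Some _ then s else s - t.
Definition ppt o (t : R) (x : 'rV[R]_n) (s : R) : R * 'rV[R]_n :=
  if o is Some a then (t, s *: delta_mx 0 a + x) else (s, x).

(** One of the two directions away from [t] stays in the open interval; it
depends on the half of [0, T] that contains [t]. *)
Lemma interior_times_dense t (e : R) : 0 <= t <= T -> 0 < e ->
  exists s, [/\ 0 < s, s < T, s != t & `|t - s| < e].
Proof.
move=> /andP[t0 tT] e0.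
have : 0 < Num.min e T by rewrite lt_min e0 T_gt0.
have : Num.min e T <= e by rewrite ge_min lexx.
have : Num.min e T <= T by rewrite ge_min lexx orbT.
move: (Num.min e T) => m mT me m0; pose d := m / 4.
have d0 : 0 < d by rewrite divr_gt0.
have de : d < e by rewrite /d; lra.
have dT : d <= T / 4 by rewrite /d; lra.
have [tT2|tT2] := leP t (T / 2).
  exists (t + d); split; [lra|lra| by rewrite -subr_eq0 addrAC subrr add0r gt_eqF|].
  by rewrite opprD addrA subrr sub0r normrN gtr0_norm.
exists (t - d); split; [lra|lra| by rewrite -subr_eq0 addrAC subrr add0r oppr_eq0 gt_eqF|].
by rewrite opprB addrCA subrr addr0 gtr0_norm.
Qed.

Lemma pfilter_proper o t : 0 <= t <= T -> ProperFilter (pfilter o t).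
Proof.
move=> tT; case: o => [a|] /=; first by typeclasses eauto.
apply: Build_ProperFilter_ex => P.
  move=> H; have {H} : \forall s \near nbhs t, s != t -> 0 <= s <= T -> P s := H.
  move/nbhs_ballP => [e /= e0 H].
  have [s [s0 sT st ts]] := interior_times_dense tT e0.
  by exists s; apply: (H s) => //=; rewrite (ltW s0) (ltW sT).
Qed.

Lemma pinc_cvg0 o t : pinc o t s @[s --> pfilter o t] --> (0 : R).
Proof.
case: o => [a|] /=; first exact: cvg_within.
rewrite -(subrr t); apply: cvgB; last exact: cvg_cst.
by apply: cvg_trans (cvg_within _) _; exact: cvg_within.
Qed.

Lemma pinc_neq0 o t : \forall s \near pfilter o t, pinc o t s != 0.
Proof.
case: o => [a|] /=; first by rewrite near_withinE; near=> s.
rewrite near_withinE /dnbhs near_withinE; near=> s => st _.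
by rewrite subr_eq0.
Unshelve. all: by end_near.
Qed.

Lemma line_near x v : V x -> \forall s \near (0 : R), V (s *: v + x).
Proof.
move=> Vx.
have : (s *: v + x) @[s --> (0 : R)] --> x.
  rewrite -[X in _ --> X](add0r x) -(scale0r v).
  by apply: cvgD; [apply: cvgZr_tmp; exact: cvg_id | exact: cvg_cst].
by apply; exact: open_nbhs_nbhs.
Qed.

Lemma ppt_slab o t x : 0 <= t <= T -> V x ->
  \forall s \near pfilter o t, slab (ppt o t x s).
Proof.
move=> tT Vx; case: o => [a|] /=.
  by apply: cvg_within; apply: filterS (line_near (delta_mx 0 a) Vx) => s.
by rewrite near_withinE; apply: filterE => s sT; split.
Qed.

Definition has_pd o F t x l := quot_cvg (F := pfilter o t) (pinc o t)
  (fun s => F (ppt o t x s).1 (ppt o t x s).2) (F t x) l.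

Lemma has_pdE o F t x : has_pd o F t x = fun l =>
  (if o is Some a then
     (fun h => h^-1 *: ((F t \o shift x) (h *: delta_mx 0 a) - F t x))
   else tquot F t x) s @[s --> pfilter o t] --> l.
Proof.
apply/funext => l; rewrite /has_pd /quot_cvg; case: o => [a|] //=.
by under eq_fun do rewrite mulrC.
Qed.

Lemma pdable_has o F t x : 0 <= t <= T ->
  pdable o F t x -> has_pd o F t x (pd o F t x).
Proof. by move=> tT; rewrite has_pdE; case: o => [a|]. Qed.

Lemma has_pd_pdable o F t x l : has_pd o F t x l -> pdable o F t x.
Proof. by rewrite has_pdE; case: o => [a|] /= H; apply/cvg_ex; exists l. Qed.

Lemma has_pd_val o F t x l : 0 <= t <= T -> has_pd o F t x l -> pd o F t x = l.
Proof.
move=> tT; have PF := pfilter_proper o tT.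
by rewrite has_pdE; case: o PF => [a|] /= PF H; apply: cvg_lim.
Qed.

Lemma has_pd_eq o F G t x l : 0 <= t <= T -> V x ->
  (forall t x, 0 <= t <= T -> V x -> F t x = G t x) ->
  has_pd o F t x l -> has_pd o G t x l.
Proof.
move=> tT Vx FG; rewrite /has_pd (FG _ _ tT Vx).
have PF := pfilter_proper o tT.
apply: quot_cvg_near; apply: filterS (ppt_slab o tT Vx) => s [].
exact: FG.
Qed.

Lemma stcont_eq F G : (forall t x, 0 <= t <= T -> V x -> F t x = G t x) ->
  stcont F -> stcont G.
Proof.
move=> FG; apply: subspace_eq_continuous => -[t x] /set_mem [tT Vx].
exact: FG.
Qed.

Lemma Ck_eq k F G : (forall t x, 0 <= t <= T -> V x -> F t x = G t x) ->
  Ck_spacetime T V k F -> Ck_spacetime T V k G.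
Proof.
elim: k F G => [|k IH] F G FG; first by move=> [cF _]; split=> //; exact: stcont_eq cF.
rewrite !CkS => -[cF H]; split; first exact: stcont_eq cF.
move=> o; have [dF kF] := H o.
have dG t x : 0 <= t <= T -> V x -> has_pd o G t x (pd o F t x).
  by move=> tT Vx; apply: (has_pd_eq tT Vx FG); apply: pdable_has => //; exact: dF.
split=> [t x tT Vx|]; first exact: has_pd_pdable (dG _ _ tT Vx).
by apply: IH kF => t x tT Vx; rewrite (has_pd_val tT (dG _ _ tT Vx)).
Qed.

Lemma Ck_pred k F : Ck_spacetime T V k.+1 F -> Ck_spacetime T V k F.
Proof.
elim: k F => [|k IH] F; first by move=> [].
by move/CkS=> [cF H]; apply/CkS; split=> // o; have [? /IH] := H o.
Qed.

(** The induction step of all the closure properties of C^k below: a candidate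
for the derivatives has to be given on the slab only, and shown to be
C^(k-1) itself. *)
Lemma Ck_intro k F (dF : option 'I_n -> R -> 'rV[R]_n -> R) : stcont F ->
  (forall o t x, 0 <= t <= T -> V x -> has_pd o F t x (dF o t x)) ->
  (forall o, Ck_spacetime T V k (dF o)) -> Ck_spacetime T V k.+1 F.
Proof.
move=> cF hF kF; apply/CkS; split=> // o; split=> [t x tT Vx|].
  exact: has_pd_pdable (hF _ _ _ tT Vx).
apply: Ck_eq (kF o) => t x tT Vx.
by rewrite (has_pd_val tT (hF _ _ _ tT Vx)).
Qed.

Lemma Ck_cont k F : Ck_spacetime T V k F -> stcont F.
Proof. by case: k => [|k] []. Qed.

Lemma stcontP F : stcont F <-> forall t x, 0 <= t <= T -> V x ->
  F z.1 z.2 @[z --> within slab (nbhs (t, x))] --> F t x.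
Proof.
rewrite /stcont subspace_continuousP; split=> H.
  by move=> t x tT Vx; apply: (H (t, x)).
by move=> [t x] [tT Vx]; apply: H.
Qed.

Lemma has_pd_cst o (a : R) t x : 0 <= t <= T -> has_pd o (fun _ _ => a) t x 0.
Proof. move=> /(pfilter_proper o) PF; exact: quot_cvg_cst. Qed.

Lemma Ck_cst k (a : R) : Ck_spacetime T V k (fun _ _ => a).
Proof.
have c (b : R) : stcont (fun _ _ => b) by apply/stcontP=> *; exact: cvg_cst.
elim: k a => [|k IH] a; first by split=> //; exact: c.
apply: (@Ck_intro _ _ (fun _ _ _ => 0)) => // o t x tT _; exact: has_pd_cst.
Qed.

Lemma Ck_has k F : Ck_spacetime T V k.+1 F -> forall o t x, 0 <= t <= T -> V x ->
  has_pd o F t x (pd o F t x).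
Proof. by move=> /CkS[_ H] o t x tT Vx; apply: pdable_has => //; apply: (H o).1. Qed.

Lemma Ck_pd k F o : Ck_spacetime T V k.+1 F -> Ck_spacetime T V k (pd o F).
Proof. by move=> /CkS[_ H]; apply: (H o).2. Qed.

Lemma has_pdD o F G t x l m : 0 <= t <= T ->
  has_pd o F t x l -> has_pd o G t x m ->
  has_pd o (fun t x => F t x + G t x) t x (l + m).
Proof. move=> /(pfilter_proper o) PF; exact: quot_cvgD. Qed.

Lemma has_pdM o F G t x l m : 0 <= t <= T ->
  has_pd o F t x l -> has_pd o G t x m ->
  has_pd o (fun t x => F t x * G t x) t x (l * G t x + F t x * m).
Proof.
move=> /(pfilter_proper o) PF; apply: quot_cvgM.
- exact: pinc_cvg0.
- exact: pinc_neq0.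
Qed.

Lemma has_pd_comp o F (h : R -> R) t x l m : 0 <= t <= T ->
  has_pd o F t x l -> is_derive (F t x) 1 h m ->
  has_pd o (fun t x => h (F t x)) t x (m * l).
Proof.
move=> /(pfilter_proper o) PF; apply: quot_cvg_comp.
- exact: pinc_cvg0.
- exact: pinc_neq0.
Qed.

Lemma CkD k F G : Ck_spacetime T V k F -> Ck_spacetime T V k G ->
  Ck_spacetime T V k (fun t x => F t x + G t x).
Proof.
have c F' G' : stcont F' -> stcont G' -> stcont (fun t x => F' t x + G' t x).
  by move=> /stcontP cF /stcontP cG; apply/stcontP => t x tT Vx; apply: cvgD; [exact: cF|exact: cG].
elim: k F G => [|k IH] F G kF kG; have cF := Ck_cont kF; have cG := Ck_cont kG.
  by split=> //; exact: c.
apply: (@Ck_intro _ _ (fun o t x => pd o F t x + pd o G t x)); first exact: c.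
- by move=> o t x tT Vx; apply: has_pdD => //; apply: Ck_has; eassumption.
- by move=> o; apply: IH; exact: Ck_pd.
Qed.

Lemma CkM k F G : Ck_spacetime T V k F -> Ck_spacetime T V k G ->
  Ck_spacetime T V k (fun t x => F t x * G t x).
Proof.
have c F' G' : stcont F' -> stcont G' -> stcont (fun t x => F' t x * G' t x).
  by move=> /stcontP cF /stcontP cG; apply/stcontP => t x tT Vx; apply: cvgM; [exact: cF|exact: cG].
elim: k F G => [|k IH] F G kF kG; have cF := Ck_cont kF; have cG := Ck_cont kG.
  by split=> //; exact: c.
apply: (@Ck_intro _ _ (fun o t x => pd o F t x * G t x + F t x * pd o G t x)).
- exact: c.
- by move=> o t x tT Vx; apply: has_pdM => //; apply: Ck_has; eassumption.
- by move=> o; apply: CkD; apply: IH; (exact: Ck_pd || exact: Ck_pred).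
Qed.

Lemma stcont_comp F (h : R -> R) : stcont F ->
  (forall t x, 0 <= t <= T -> V x -> {for F t x, continuous h}) ->
  stcont (fun t x => h (F t x)).
Proof.
move=> /stcontP cF ch; apply/stcontP => t x tT Vx.
by apply: continuous_cvg; [exact: ch | exact: cF].
Qed.

Lemma is_derive_inv (a : R) : a != 0 -> is_derive a 1 (fun y : R => y^-1) (- (a^-1 * a^-1)).
Proof.
move=> a0; have da : derivable (id : R -> R) a 1 by exact: derivable_id.
split; first exact: (@derivableV _ _ id).
rewrite (@deriveV _ _ id) // derive_id /GRing.scale /= mulr1.
by rewrite -exprVn expr2.
Qed.

Lemma Ck_inv k F : (forall t x, 0 <= t <= T -> V x -> F t x != 0) ->
  Ck_spacetime T V k F -> Ck_spacetime T V k (fun t x => (F t x)^-1).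
Proof.
move=> F0; elim: k => [|k IH] kF; have cF := Ck_cont kF.
  split=> //; apply: stcont_comp => // t x tT Vx; exact/inv_continuous/F0.
apply: (@Ck_intro _ _ (fun o t x => - 1 * ((F t x)^-1 * (F t x)^-1) * pd o F t x)).
- by apply: stcont_comp => // t x tT Vx; exact/inv_continuous/F0.
- move=> o t x tT Vx; rewrite mulN1r; apply: has_pd_comp => //.
    exact: Ck_has kF _ _ _ tT Vx.
  exact/is_derive_inv/F0.
- move=> o; apply: CkM; last exact: Ck_pd.
  apply: CkM; first exact: Ck_cst.
  by apply: CkM; exact: IH (Ck_pred kF).
Qed.

Lemma Ck_ln k F : (forall t x, 0 <= t <= T -> V x -> 0 < F t x) ->
  Ck_spacetime T V k F -> Ck_spacetime T V k (fun t x => ln (F t x)).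
Proof.
move=> F0; case: k => [|k] kF; have cF := Ck_cont kF.
  by split=> //; apply: stcont_comp => // t x tT Vx; exact/continuous_ln/F0.
apply: (@Ck_intro _ _ (fun o t x => (F t x)^-1 * pd o F t x)).
- by apply: stcont_comp => // t x tT Vx; exact/continuous_ln/F0.
- move=> o t x tT Vx; apply: has_pd_comp => //.
    exact: Ck_has kF _ _ _ tT Vx.
  exact/is_derive1_ln/F0.
- move=> o; apply: CkM; last exact: Ck_pd.
  by apply: Ck_inv; [move=> t x tT Vx; exact/lt0r_neq0/F0|exact: Ck_pred].
Qed.
End SpacetimeCalculus.

(** * Commutation of partial derivatives, up to the ends of the time interval *)

Section Schwarz.
Context {R : realType} {E : normedModType R}.
Implicit Types (f : E -> R) (v w z : E).

Lemma is_derive_line f v x (r : R) : derivable f (r *: v + x) v ->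
  is_derive r 1 (fun s : R => f (s *: v + x)) ('D_v f (r *: v + x)).
Proof.
have Eq : (fun h : R => h^-1 *: (((fun s : R => f (s *: v + x)) \o shift r) (h *: 1)
                       - f (r *: v + x)))
   = (fun h : R => h^-1 *: ((f \o shift (r *: v + x)) (h *: v) - f (r *: v + x))).
  apply/funext => h /=; congr (_ *: (f _ - _)).
  by rewrite [h%:A]mulr1 scalerDl addrA.
by move=> df; split; rewrite /derivable /derive Eq.
Qed.

(** The mean value theorem applied to the difference in the direction [w] as a
function along [v], and then to the derivative along [v] as a function along
[w]. *)
Lemma second_difference f v w z (h : R) : 0 < h ->
  (forall a b : R, 0 <= a <= h -> 0 <= b <= h ->
     derivable f (a *: v + (b *: w + z)) v /\
     derivable ('D_v f) (b *: w + (a *: v + z)) w) ->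
  exists a b : R, [/\ 0 <= a <= h, 0 <= b <= h &
    f (h *: v + (h *: w + z)) - f (h *: v + z) - (f (h *: w + z) - f z)
    = h * h * 'D_w ('D_v f) (b *: w + (a *: v + z))].
Proof.
move=> h0 good.
have h00 : 0 <= (0 : R) <= h by apply/andP; split=> //; exact: ltW.
have hh : 0 <= h <= h by apply/andP; split=> //; exact: ltW.
have z0 : 0 *: w + z = z by rewrite scale0r add0r.
pose phi (r : R) := f (r *: v + (h *: w + z)) - f (r *: v + z).
pose dphi (r : R) := 'D_v f (r *: v + (h *: w + z)) - 'D_v f (r *: v + z).
have dphiP (r : R) : 0 <= r <= h -> is_derive r 1 phi (dphi r).
  move=> rh; apply: is_deriveB; apply: is_derive_line.
    exact: (good r h rh hh).1.
  by have := (good r 0 rh h00).1; rewrite z0.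
have [||a ah Ea] := @MVT R phi dphi 0 h h0.
- by move=> r; rewrite in_itv /= => /andP[/ltW r0 /ltW rh]; apply: dphiP; rewrite r0.
- apply: derivable_within_continuous => r; rewrite in_itv /= => rh.
  exact: (@ex_derive _ _ _ _ _ _ _ (dphiP r rh)).
have {}ah : 0 <= a <= h by move: ah; rewrite in_itv /= => /andP[/ltW -> /ltW].
pose psi (s : R) := 'D_v f (s *: w + (a *: v + z)).
pose dpsi (s : R) := 'D_w ('D_v f) (s *: w + (a *: v + z)).
have dpsiP (s : R) : 0 <= s <= h -> is_derive s 1 psi (dpsi s).
  by move=> sh; apply: is_derive_line; exact: (good a s ah sh).2.
have [||b bh Eb] := @MVT R psi dpsi 0 h h0.
- by move=> r; rewrite in_itv /= => /andP[/ltW r0 /ltW rh]; apply: dpsiP; rewrite r0.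
- apply: derivable_within_continuous => r; rewrite in_itv /= => rh.
  exact: (@ex_derive _ _ _ _ _ _ _ (dpsiP r rh)).
exists a, b; split => //.
  by move: bh; rewrite in_itv /= => /andP[/ltW -> /ltW].
have -> : f (h *: v + (h *: w + z)) - f (h *: v + z) - (f (h *: w + z) - f z)
   = phi h - phi 0 by rewrite /phi scale0r !add0r.
rewrite Ea -/(dpsi b).
have -> : dphi a = psi h - psi 0.
  rewrite /dphi /psi scale0r add0r; congr ('D_v f _ - _).
  by rewrite addrCA.
by rewrite Eb; ring.
Qed.

Lemma square_near (P : set E) v w z : (\forall y \near z, P y) ->
  exists2 h : R, 0 < h & forall a b : R, 0 <= a <= h -> 0 <= b <= h ->
    P (b *: w + (a *: v + z)).
Proof.
move=> /nbhs_ballP[e /= e0 eP].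
pose M := `|v| + `|w| + 1.
have M0 : 0 < M by rewrite ltr_wpDl // addr_ge0.
pose h := e / (2 * M); have h0 : 0 < h by rewrite divr_gt0 // mulr_gt0.
exists h => // a b /andP[a0 ah] /andP[b0 bh]; apply: eP.
rewrite -ball_normE /= addrA [X in _ - X]addrC opprD addrA subrr add0r normrN.
apply: (le_lt_trans (ler_normD _ _)); rewrite !normrZ !ger0_norm //.
apply: (@le_lt_trans _ _ (h * (`|v| + `|w|))).
  rewrite mulrDr addrC; apply: lerD; exact: ler_wpM2r.
have -> : e = h * (2 * M) by rewrite /h divfK // mulf_neq0 // gt_eqF.
rewrite ltr_pM2l //; rewrite /M.
have := normr_ge0 v; have := normr_ge0 w; lra.
Qed.

(** The second difference of [f] on a small parallelogram is symmetric in the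
two directions and equals the square of the side times either mixed
derivative at some point of the parallelogram; both mixed derivatives are
continuous at [z]. *)
Lemma schwarz f v w z :
  (\forall y \near z, derivable f y v) -> (\forall y \near z, derivable f y w) ->
  (\forall y \near z, derivable ('D_v f) y w) ->
  (\forall y \near z, derivable ('D_w f) y v) ->
  {for z, continuous ('D_w ('D_v f))} -> {for z, continuous ('D_v ('D_w f))} ->
  'D_w ('D_v f) z = 'D_v ('D_w f) z.
Proof.
move=> dv dw dvw dwv cvw cwv.
apply/eqP; rewrite -subr_eq0 -normr_le0; apply/ler_addgt0Pl => e e0.
rewrite addr0.
have e20 : 0 < e / 2 by rewrite divr_gt0.
have : \forall y \near z, `|'D_w ('D_v f) z - 'D_w ('D_v f) y| < e / 2.
  by move/cvgrPdist_lt : cvw; apply.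
have : \forall y \near z, `|'D_v ('D_w f) z - 'D_v ('D_w f) y| < e / 2.
  by move/cvgrPdist_lt : cwv; apply.
move=> n2 n1.
have [h h0 G] := square_near v w
  (filterI (filterI (filterI dv dw) (filterI dvw dwv)) (filterI n1 n2)).
have swap (a b : R) y : a *: v + (b *: w + y) = b *: w + (a *: v + y) by rewrite addrCA.
have [a [b [ah bh E1]]] : exists a b : R, [/\ 0 <= a <= h, 0 <= b <= h &
    f (h *: v + (h *: w + z)) - f (h *: v + z) - (f (h *: w + z) - f z)
    = h * h * 'D_w ('D_v f) (b *: w + (a *: v + z))].
  apply: (@second_difference f v w z h h0) => a b ah bh.
  have [[[? ?] [? ?]] _] := G a b ah bh.
  rewrite swap; split; assumption.
have [b' [a' [bh' ah' E2]]] : exists b a : R, [/\ 0 <= b <= h, 0 <= a <= h &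
    f (h *: w + (h *: v + z)) - f (h *: w + z) - (f (h *: v + z) - f z)
    = h * h * 'D_v ('D_w f) (a *: v + (b *: w + z))].
  apply: (@second_difference f w v z h h0) => b1 a1 bh1 ah1.
  have [[[? ?] [? ?]] _] := G a1 b1 ah1 bh1.
  rewrite swap; split; assumption.
have [_ [m1 _]] := G a b ah bh; have [_ [_ m2]] := G a' b' ah' bh'.
have E3 : 'D_w ('D_v f) (b *: w + (a *: v + z)) = 'D_v ('D_w f) (b' *: w + (a' *: v + z)).
  have hh0 : h * h != 0 by rewrite mulf_neq0 ?gt_eqF.
  have subACA (p q r s : R) : p - q - (r - s) = p - r - (q - s) by ring.
  rewrite (swap h h z) subACA in E1; rewrite (swap a' b' z) in E2.
  exact: (mulfI hh0 (etrans (esym E1) E2)).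
move: m1 m2; rewrite E3.
move: ('D_w ('D_v f) z) ('D_v ('D_w f) z) ('D_v ('D_w f) _) => p q r m1 m2.
have -> : p - q = (p - r) - (q - r) by ring.
apply: (le_trans (ler_normB _ _)); apply: ltW; rewrite [e]splitr; exact: ltrD.
Qed.
End Schwarz.

Section Commutation.
Context {R : realType} {n : nat}.
Variables (T : R) (V : set 'rV[R]_n).
Hypothesis T_gt0 : 0 < T.
Hypothesis V_open : open V.
Implicit Types (F G : R -> 'rV[R]_n -> R) (o : option 'I_n).

Local Notation ev F := (fun z : R * 'rV[R]_n => F z.1 z.2).

(** At times in the open interval the derivative of index [o] is the directional
derivative of the normed space R x R^n along [dir o]. *)
Definition dir o : (R * 'rV[R]_n)%type :=
  if o is Some a then (0, delta_mx 0 a) else (1, 0).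

Definition interior_slab : set (R * 'rV[R]_n) := [set z | 0 < z.1 < T /\ V z.2].

Lemma interior_slab_open : open interior_slab.
Proof.
have -> : interior_slab = (fun z : R * 'rV[R]_n => z.1) @^-1` `]0, T[%classic
             `&` (fun z => z.2) @^-1` V.
  by apply/seteqP; split=> z /=; rewrite /interior_slab /= in_itv.
apply: openI; apply: open_comp => //.
- by move=> z _; exact: cvg_fst.
- by move=> z _; exact: cvg_snd.
Qed.

Lemma interior_slab_near z : interior_slab z -> \forall y \near z, interior_slab y.
Proof. by move=> iz; exact: open_nbhs_nbhs (conj interior_slab_open iz). Qed.

Lemma interior_slab_sub : interior_slab `<=` slab T V.
Proof. by move=> z [/andP[/ltW t0 /ltW tT] Vz]; split=> //; rewrite t0. Qed.

Lemma interior_derive o F t x l : interior_slab (t, x) -> has_pd T o F t x l ->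
  derivable (ev F) (t, x) (dir o) /\ 'D_(dir o) (ev F) (t, x) = l.
Proof.
move=> /[dup] iz [/= /andP[t0 tT] Vx]; rewrite has_pdE => H.
have : (fun h : R => h^-1 *: ((ev F \o shift (t, x)) (h *: dir o) - F t x)) @ 0^' --> l.
  case: o H => [a|] H /=.
    move: H; apply: cvg_trans; apply: near_eq_cvg; near=> h.
    by rewrite /= scaler0 add0r.
  have -> : (fun h : R => h^-1 *: (F (h *: 1 + t) (h *: 0 + x) - F t x)) =
      tquot F t x \o (fun h => h + t).
    apply/funext => h; rewrite /tquot /= scaler0 add0r [h%:A]mulr1 addrK.
    by rewrite [LHS]mulrC.
  apply: cvg_comp H => P.
  move=> HP'; have {HP'} HP : \forall s \near nbhs t, s != t -> 0 <= s <= T -> P s := HP'.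
  suff : \forall h \near nbhs (0 : R), h != 0 -> P (h + t) by [].
  have c : (h + t) @[h --> (0 : R)] --> t.
    rewrite -[X in _ --> X](add0r t).
    by apply: cvgD; [exact: cvg_id | exact: cvg_cst].
  have HT : \forall s \near nbhs t, 0 <= s <= T.
    have : t \in `]0, T[ by rewrite in_itv /= t0.
    move/near_in_itvoo; apply: filterS => s; rewrite in_itv /=.
    by move=> /andP[/ltW -> /ltW].
  have /c : \forall s \near nbhs t, (s != t -> 0 <= s <= T -> P s) /\ 0 <= s <= T.
    exact: filterI HP HT.
  move=> cc; have {cc} : \forall h \near nbhs (0 : R),
    (h + t != t -> 0 <= h + t <= T -> P (h + t)) /\ 0 <= h + t <= T := cc.
  apply: filterS => h /= [hP hT] h0; apply: hP => //.
  by rewrite -subr_eq0 addrK.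
move=> {}H; split; first by apply/cvg_ex; exists l.
exact: cvg_lim.
Unshelve. all: by end_near.
Qed.

Lemma interior_cont F z : stcont T V F -> interior_slab z -> {for z, continuous (ev F)}.
Proof.
move=> /stcontP cF iz; have [/= tT Vx] := interior_slab_sub iz.
have := cF _ _ tT Vx; case: z iz tT Vx => t x iz tT Vx.
rewrite /continuous_at /=; apply: cvg_trans => P /= HP.
have HP' : \forall y \near (t, x), slab T V y -> P (F y.1 y.2) := HP.
have : \forall y \near (t, x), P (F y.1 y.2).
  by apply: filterS2 HP' (interior_slab_near iz) => y h iy; exact/h/interior_slab_sub.
exact.
Qed.

Lemma pd_comm_interior F o o' z : Ck_spacetime T V 2 F -> interior_slab z ->
  pd T o (pd T o' F) z.1 z.2 = pd T o' (pd T o F) z.1 z.2.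
Proof.
move=> kF iz.
have D1 p y : interior_slab y -> derivable (ev F) y (dir p) /\
                         'D_(dir p) (ev F) y = pd T p F y.1 y.2.
  move=> iy; have [tT Vx] := interior_slab_sub iy.
  have := @Ck_has _ _ _ _ _ _ (Ck_pred kF) p _ _ tT Vx.
  by case: y iy tT Vx => t x iy tT Vx; exact: interior_derive.
have E1 p y : interior_slab y -> {near y, 'D_(dir p) (ev F) =1 ev (pd T p F)}.
  by move=> iy; apply: filterS (interior_slab_near iy) => u /(D1 p)[].
have D2 p q y : interior_slab y -> derivable ('D_(dir p) (ev F)) y (dir q) /\
     'D_(dir q) ('D_(dir p) (ev F)) y = pd T q (pd T p F) y.1 y.2.
  move=> iy; have [tT Vx] := interior_slab_sub iy.
  have := @Ck_has _ _ _ _ _ _ (Ck_pd p kF) q _ _ tT Vx.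
  case: y iy tT Vx => t x iy tT Vx /(interior_derive iy) [dp vp].
  split; last by rewrite (near_eq_derive _ (E1 p _ iy)).
  by apply: near_eq_derivable dp; apply: filterS (E1 p _ iy) => u ->.
have C2 p q : {for z, continuous ('D_(dir q) ('D_(dir p) (ev F)))}.
  have cpq : {for z, continuous (ev (pd T q (pd T p F)))}.
    by apply: interior_cont => //; exact: Ck_cont (Ck_pd q (Ck_pd p kF)).
  suff : 'D_(dir q) ('D_(dir p) (ev F)) u @[u --> z]
         --> 'D_(dir q) ('D_(dir p) (ev F)) z by [].
  have {}cpq : ev (pd T q (pd T p F)) u @[u --> z] --> pd T q (pd T p F) z.1 z.2 := cpq.
  rewrite (D2 p q z iz).2; apply: cvg_trans cpq; apply: near_eq_cvg.
  by apply: filterS (interior_slab_near iz) => u /(D2 p q)[_ ->].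
rewrite -(D2 o' o z iz).2 -(D2 o o' z iz).2; apply: schwarz => //.
- by apply: filterS (interior_slab_near iz) => u /(D1 o')[].
- by apply: filterS (interior_slab_near iz) => u /(D1 o)[].
- by apply: filterS (interior_slab_near iz) => u /(D2 o' o)[].
- by apply: filterS (interior_slab_near iz) => u /(D2 o o')[].
Qed.

(** Every point of the slab is a limit of points of its interior at the same
position in space. *)
Lemma eq_from_interior F G t x : stcont T V F -> stcont T V G ->
  (forall z, interior_slab z -> F z.1 z.2 = G z.1 z.2) ->
  0 <= t <= T -> V x -> F t x = G t x.
Proof.
move=> /stcontP cF /stcontP cG FG tT Vx.
pose Fl := within [set s | 0 < s < T] (nbhs t).
have PF : ProperFilter Fl.
  apply: Build_ProperFilter_ex => P.
  move=> H; have {H} : \forall s \near nbhs t, 0 < s < T -> P s := H.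
  move/nbhs_ballP => [e /= e0 H].
  have [s [s0 sT st ts]] := interior_times_dense T_gt0 tT e0.
  by exists s; apply: (H s) => //=; rewrite s0.
have l1 (H : R -> 'rV[R]_n -> R) :
    (H z.1 z.2 @[z --> within (slab T V) (nbhs (t, x))] --> H t x) ->
    (H s x @[s --> Fl] --> H t x).
  apply: cvg_trans => P /= HP.
  have HP' : \forall y \near (t, x), slab T V y -> P (H y.1 y.2) := HP.
  have c : (s, x) @[s --> t] --> (t, x) by exact: (cvg_pair cvg_id (cvg_cst x)).
  have cP : \forall s \near nbhs t, slab T V (s, x) -> P (H s x) := c _ HP'.
  suff : \forall s \near nbhs t, 0 < s < T -> P (H s x) by [].
  apply: filterS cP => s + /andP[s0 sT].
  by apply; split=> //=; rewrite (ltW s0) (ltW sT).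
have lF := l1 F (cF _ _ tT Vx); have lG := l1 G (cG _ _ tT Vx).
have lF' : G s x @[s --> Fl] --> F t x.
  apply: cvg_trans lF; apply: near_eq_cvg; rewrite near_withinE.
  by apply: filterE => s sT; rewrite (FG (s, x)).
exact: (cvg_unique _ lF' lG).
Qed.

Lemma pd_comm F o o' t x : Ck_spacetime T V 2 F -> 0 <= t <= T -> V x ->
  pd T o (pd T o' F) t x = pd T o' (pd T o F) t x.
Proof.
move=> kF; apply: eq_from_interior.
- exact: Ck_cont (Ck_pd o (Ck_pd o' kF)).
- exact: Ck_cont (Ck_pd o' (Ck_pd o kF)).
- by move=> z; apply: pd_comm_interior.
Qed.
End Commutation.

(** * The chain rule along a curve *)

Section MeanValueLine.
Context {R : realType} {E : normedModType R}.

(** The step [g] may be negative: it will be the increment of a coordinate along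
a curve. *)
Lemma mvt_line (F : E -> R) (v q : E) (g : R) :
  (forall r : R, `|r| <= `|g| -> derivable F (r *: v + q) v) ->
  exists2 r : R, `|r| <= `|g| &
    F (g *: v + q) - F q = g * 'D_v F (r *: v + q).
Proof.
move=> dF.
have dl (r : R) : `|r| <= `|g| ->
    is_derive r 1 (fun s : R => F (s *: v + q)) ('D_v F (r *: v + q)).
  by move=> rg; apply: is_derive_line; exact: dF.
have e0 : F q = F (0 *: v + q) by rewrite scale0r add0r.
have [g0|g0|<-] := ltgtP 0 g.
- have ng r : r \in `[0, g] -> `|r| <= `|g|.
    by rewrite in_itv /= => /andP[r0 rg]; rewrite !ger0_norm // ltW.
  have [||c cg Ec] := @MVT R (fun s : R => F (s *: v + q)) (fun r : R => 'D_v F (r *: v + q)) 0 g g0.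
  + by move=> r rg; apply: dl; apply: ng; move: rg; rewrite !in_itv /= => /andP[/ltW -> /ltW].
  + by apply: derivable_within_continuous => r /ng/dl[].
  exists c; last by rewrite e0 Ec subr0 mulrC.
  by apply: ng; move: cg; rewrite !in_itv /= => /andP[/ltW -> /ltW].
- have ng r : r \in `[g, 0] -> `|r| <= `|g|.
    rewrite in_itv /= => /andP[gr r0].
    by rewrite !ler0_norm ?lerN2 // (le_trans gr).
  have [||c cg Ec] := @MVT R (fun s : R => F (s *: v + q)) (fun r : R => 'D_v F (r *: v + q)) g 0 g0.
  + by move=> r rg; apply: dl; apply: ng; move: rg; rewrite !in_itv /= => /andP[/ltW -> /ltW].
  + by apply: derivable_within_continuous => r /ng/dl[].
  exists c; last by rewrite e0 -[LHS]opprB Ec sub0r mulrN opprK mulrC.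
  by apply: ng; move: cg; rewrite !in_itv /= => /andP[/ltW -> /ltW].
- exists 0; rewrite ?normr0 ?normr_ge0 // mul0r.
  by rewrite scale0r add0r subrr.
Qed.
End MeanValueLine.

Lemma cvg_bigsum (R : realType) (W : normedModType R) (X : Type)
    (Fl : set_system X) {FF : Filter Fl} (J : Type) (s : seq J) (P : pred J)
    (f : J -> X -> W) (l : J -> W) :
  (forall j, f j x @[x --> Fl] --> l j) ->
  \sum_(j <- s | P j) f j x @[x --> Fl] --> \sum_(j <- s | P j) l j.
Proof.
move=> fl; elim: s => [|j s IH].
  rewrite big_nil; under eq_fun do rewrite big_nil; exact: cvg_cst.
rewrite big_cons; under eq_fun do rewrite big_cons.
by case: (P j) => //; apply: cvgD.
Qed.

Section ChainRule.
Context {R : realType} {n : nat}.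
Implicit Types (F : 'rV[R]_n -> R) (p : 'rV[R]_n).

Definition quot0 (phi : R -> R) a l := quot_cvg (F := 0^') id phi a l.

(** Continuity of the partial derivatives is enough: the coordinates are moved
one at a time, and the mean value theorem turns each move into the increment
of the coordinate times a value of the partial derivative near [p]. *)
Lemma chain_curve F p (gam : 'I_n -> R -> R) (m : 'I_n -> R) :
  (forall a, \forall y \near p, pderivable a F y) ->
  (forall a, {for p, continuous (pderiv a F)}) ->
  (forall a, quot0 (gam a) 0 (m a)) ->
  quot0 (fun h => F (\sum_a gam a h *: delta_mx 0 a + p)) (F p)
        (\sum_a m a * pderiv a F p).
Proof.
move=> dF cF dgam.
have id0 : (id s : R) @[s --> 0^'] --> (0 : R) by exact: cvg_within.
have idn0 : \forall s \near 0^', (id s : R) != 0.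
  by rewrite near_withinE; near=> s.
have gam0 a : gam a h @[h --> 0^'] --> (0 : R).
  exact: quot_cvg_continuous (dgam a).
(* The displacement after the first k coordinates have been moved. *)
pose sig k (h : R) : 'rV[R]_n := \sum_(a < n | (a < k)%N) gam a h *: delta_mx 0 a.
have sig0 k : sig k h @[h --> 0^'] --> (0 : 'rV[R]_n).
  have -> : (0 : 'rV[R]_n) = \sum_(a < n | (a < k)%N) (0 : R) *: delta_mx 0 a.
    by rewrite big1 // => a _; rewrite scale0r.
  apply: cvg_bigsum => a; apply: cvgZr_tmp; exact: gam0.
suff H k : (k <= n)%N -> quot0 (fun h => F (sig k h + p)) (F p)
    (\sum_(a < n | (a < k)%N) m a * pderiv a F p).
  have := H n (leqnn n).
  have -> : (fun h => F (sig n h + p)) =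
            (fun h => F (\sum_a gam a h *: delta_mx 0 a + p)).
    by apply/funext => h; congr (F (_ + p)); apply: eq_bigl => a; rewrite ltn_ord.
  by under eq_bigl do rewrite ltn_ord.
elim: k => [_|k IH kn].
  have -> : (fun h => F (sig 0%N h + p)) = (fun=> F p).
    by apply/funext => h; rewrite /sig big_pred0 ?add0r.
  rewrite big_pred0 //; exact: quot_cvg_cst.
pose c := Ordinal kn.
have split_sum (A : nmodType) (f : 'I_n -> A) :
    \sum_(a < n | (a < k.+1)%N) f a = f c + \sum_(a < n | (a < k)%N) f a.
  rewrite (bigD1 c) /=; last exact: ltnSn.
  congr (_ + _); apply: eq_bigl => a.
  by rewrite ltnS ltn_neqAle -val_eqE /= andbC.
(* The slope of the move of the coordinate k, extended by its limit, so that
   increments equal to 0 do no harm. *)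
pose G (h : R) := if gam c h == 0 then pderiv c F p
   else (F (sig k.+1 h + p) - F (sig k h + p)) / gam c h.
have GE h : F (sig k.+1 h + p) = F (sig k h + p) + gam c h * G h.
  rewrite /G; case: eqP => [g0|/eqP g0].
    by rewrite g0 mul0r addr0 /sig split_sum g0 scale0r add0r.
  by rewrite mulrC divfK // [RHS]addrC subrK.
have Gc : G h @[h --> 0^'] --> pderiv c F p.
  apply/cvgrPdist_lt => e e0.
  have n1 : \forall y \near p, `|pderiv c F p - pderiv c F y| < e.
    by have /cvgrPdist_lt := cF c; apply.
  have /nbhs_ballP[d /= d0 dP] : \forall y \near p,
      pderivable c F y /\ `|pderiv c F p - pderiv c F y| < e.
    exact: filterI (dF c) n1.
  have d20 : 0 < d / 2 by rewrite divr_gt0.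
  have ns : \forall h \near 0^', `|sig k h| < d / 2.
    have /cvgrPdist_lt/(_ _ d20) := sig0 k.
    by apply: filterS => h; rewrite sub0r normrN.
  have ng : \forall h \near 0^', `|gam c h| * `|delta_mx 0 c : 'rV[R]_n| < d / 2.
    have : gam c h *: (delta_mx 0 c : 'rV[R]_n) @[h --> 0^'] --> (0 : R) *: (delta_mx 0 c : 'rV[R]_n).
      by apply: cvgZr_tmp; exact: gam0.
    move/cvgrPdist_lt/(_ _ d20); rewrite scale0r.
    by apply: filterS => h; rewrite sub0r normrN normrZ.
  apply: filterS2 ns ng => h hs hg; rewrite /G.
  case: eqP => [_|/eqP g0]; first by rewrite subrr normr0.
  have good (r : R) : `|r| <= `|gam c h| ->
      pderivable c F (r *: delta_mx 0 c + (sig k h + p)) /\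
      `|pderiv c F p - pderiv c F (r *: delta_mx 0 c + (sig k h + p))| < e.
    move=> rg; apply: dP; rewrite -ball_normE /=.
    rewrite addrA [X in _ - X]addrC opprD addrA subrr add0r normrN.
    apply: (le_lt_trans (ler_normD _ _)); rewrite [d]splitr; apply: ltrD => //.
    by rewrite normrZ; apply: le_lt_trans hg; exact: ler_wpM2r.
  have [r rg Er] := mvt_line (fun r hr => (good r hr).1).
  have -> : sig k.+1 h + p = gam c h *: delta_mx 0 c + (sig k h + p).
    by rewrite /sig split_sum addrA.
  by rewrite Er mulrAC mulfV // mul1r; exact: (good r rg).2.
have step : quot0 (fun h => F (sig k h + p) + gam c h * G h) (F p)
   (\sum_(a < n | (a < k)%N) m a * pderiv a F p + m c * pderiv c F p).
  rewrite /quot0 /quot_cvg.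
  have -> : (fun h : R => (F (sig k h + p) + gam c h * G h - F p) / id h)
     = (fun h => (F (sig k h + p) - F p) / id h + (gam c h - 0) / id h * G h).
    by apply/funext => h; ring.
  apply: cvgD; first exact: IH (ltnW kn).
  by apply: cvgM => //; exact: dgam.
have -> : (fun h => F (sig k.+1 h + p)) = (fun h => F (sig k h + p) + gam c h * G h).
  by apply/funext => h; rewrite GE.
by rewrite split_sum addrC.
Unshelve. all: by end_near.
Qed.
End ChainRule.

(** * First and second order conditions at a maximum *)

(** A positive derivative of [dg] at its zero 0 would make [dg] positive just
after 0, and [g] would exceed its maximum there by the mean value theorem. *)
Lemma second_derivative_test (R : realType) (g dg : R -> R) (m d : R) : 0 < d ->
  (forall r : R, `|r| < d -> is_derive r 1 g (dg r)) -> is_derive (0 : R) 1 dg m ->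
  (forall r, `|r| < d -> g r <= g 0) -> dg 0 = 0 /\ m <= 0.
Proof.
move=> d0 dgP [ddg <-] gmax.
have inI (r : R) : r \in `]- d, d[ -> `|r| < d by rewrite in_itv /= ltr_norml.
have dg0 : dg 0 = 0.
  have I0 : (0 : R) \in `]- d, d[ by rewrite in_itv /= oppr_lt0 d0.
  have dd : - d <= d by lra.
  have [_ E1] := derive1_at_max dd (fun r hr => @ex_derive _ _ _ _ _ _ _ (dgP r (inI r hr)))
    I0 (fun r hr => gmax r (inI r hr)).
  by have [_ E2] := dgP 0 (inI _ I0); rewrite -E2 E1.
split=> //; rewrite leNgt; apply/negP => m0.
have : \forall r \near 0^', 0 < r^-1 *: ((dg \o shift 0) (r *: 1) - dg 0).
  by have /cvgr_gt/(_ _ m0) := ddg; apply.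
rewrite near_withinE => /nbhs_ballP[e /= e0 He].
pose r := Num.min e d / 2.
have m0' : 0 < Num.min e d by rewrite lt_min e0.
have r0 : 0 < r by rewrite divr_gt0.
have rm : r < Num.min e d by rewrite /r; move: (Num.min e d) m0' => q; lra.
move: rm; rewrite lt_min => /andP[re rd].
have [||c] := @MVT R g dg 0 r r0.
- move=> s; rewrite in_itv /= => /andP[s0 sr]; apply: dgP.
  by rewrite gtr0_norm // (lt_trans sr).
- apply: derivable_within_continuous => s; rewrite in_itv /= => /andP[s0 sr].
  by have [] : is_derive s 1 g (dg s) by apply: dgP; rewrite ger0_norm // (le_lt_trans sr).
rewrite in_itv /= => /andP[c0 cr] Ec.
have : g r - g 0 <= 0 by rewrite subr_le0 gmax // gtr0_norm.
rewrite Ec subr0 leNgt mulr_gt0 //.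
have := He c; rewrite -ball_normE /= sub0r normrN gtr0_norm // (lt_trans cr) //.
move=> /(_ isT); rewrite gt_eqF // => /(_ isT).
by rewrite /= addr0 [c%:A]mulr1 dg0 subr0 /GRing.scale /= pmulr_rgt0 // invr_gt0.
Qed.

Section MaximumInSpace.
Context {R : realType} {n : nat}.
Variables (V : set 'rV[R]_n) (F : 'rV[R]_n -> R).
Hypothesis V_open : open V.
Hypothesis dF : forall a x, V x -> pderivable a F x.
Hypothesis ddF : forall a b x, V x -> pderivable b (pderiv a F) x.
Hypothesis cF : forall a x, V x -> {for x, continuous (pderiv a F)}.
Hypothesis ccF : forall a b x, V x -> {for x, continuous (pderiv b (pderiv a F))}.

Lemma directional G x v :
  (forall a x, V x -> pderivable a G x) ->
  (forall a x, V x -> {for x, continuous (pderiv a G)}) -> V x ->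
  derivable G x v /\ 'D_v G x = \sum_a v 0 a * pderiv a G x.
Proof.
move=> dG cG Vx.
have Vn : \forall y \near x, V y by exact: open_nbhs_nbhs.
have H : quot0 (fun h => G (\sum_a (h * v 0 a) *: delta_mx 0 a + x)) (G x)
    (\sum_a v 0 a * pderiv a G x).
  apply: chain_curve => a.
  - by apply: filterS Vn => y; exact: dG.
  - exact: cG.
  - rewrite /quot0 /quot_cvg.
    have c : (fun=> v 0 a) h @[h --> (0 : R)^'] --> v 0 a by exact: cvg_cst.
    apply: cvg_trans c; apply: near_eq_cvg; rewrite near_withinE.
    apply: filterE => h h0.
    by rewrite subr0 mulrAC mulfV // mul1r.
have E h : \sum_a (h * v 0 a) *: delta_mx 0 a = h *: v.
  rewrite [v in RHS]row_sum_delta scaler_sumr.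
  by apply: eq_bigr => j _; rewrite scalerA.
have H' : (fun h : R => h^-1 *: ((G \o shift x) (h *: v) - G x)) @ 0^' -->
    \sum_a v 0 a * pderiv a G x.
  move: H; rewrite /quot0 /quot_cvg; under eq_fun do rewrite E mulrC.
  exact.
split; first by apply/cvg_ex; exists (\sum_a v 0 a * pderiv a G x).
exact: cvg_lim.
Qed.

(** The test in one variable along each line through [x]; the second derivative
along the line is the Hessian form because partial derivatives are continuous
([directional], used for F and for each of its partial derivatives). *)
Lemma max_in_space x : V x -> (forall y, V y -> F y <= F x) ->
  (forall a, pderiv a F x = 0) /\
  forall v : 'rV[R]_n, \sum_a \sum_b v 0 a * v 0 b * pderiv b (pderiv a F) x <= 0.
Proof.
move=> Vx Fmax.
have main (v : 'rV[R]_n) : \sum_a v 0 a * pderiv a F x = 0 /\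
   \sum_a \sum_b v 0 a * v 0 b * pderiv b (pderiv a F) x <= 0.
  have [e e0 He] : exists2 e : R, 0 < e & forall r : R, `|r| < e -> V (r *: v + x).
    have /nbhs_ballP[e /= e0 He] := line_near V_open v Vx.
    by exists e => // r re; apply: He; rewrite -ball_normE /= sub0r normrN.
  pose dg (r : R) := \sum_a v 0 a * pderiv a F (r *: v + x).
  have x0 : 0 *: v + x = x by rewrite scale0r add0r.
  have := @second_derivative_test R (fun r => F (r *: v + x)) dg
    (\sum_a \sum_b v 0 a * v 0 b * pderiv b (pderiv a F) x) e e0.
  rewrite /dg x0; apply.
  - move=> r re; have [dv <-] := directional v dF cF (He r re).
    exact: is_derive_line.
  - have -> : (fun r : R => \sum_a v 0 a * pderiv a F (r *: v + x)) =
        \sum_a (fun r : R => v 0 a * pderiv a F (r *: v + x)).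
      by apply/funext => r; rewrite fct_sumE.
    apply: is_derive_sum => a.
    have [dv Dv] := directional v (@ddF a) (@ccF a) Vx.
    have L : is_derive (0 : R) 1 (fun r : R => pderiv a F (r *: v + x))
        (\sum_b v 0 b * pderiv b (pderiv a F) x).
      by rewrite -Dv -[x in 'D_v _ x]x0; apply: is_derive_line; rewrite x0.
    have -> : \sum_b v 0 a * v 0 b * pderiv b (pderiv a F) x
            = v 0 a *: \sum_b v 0 b * pderiv b (pderiv a F) x.
      rewrite /GRing.scale /= mulr_sumr.
      by apply: eq_bigr => b _; rewrite mulrA.
    exact: is_deriveZ L.
  - by move=> r re; apply: Fmax; exact: He.
split; last by move=> v; have [] := main v.
move=> a; have [+ _] := main (delta_mx 0 a).
rewrite (bigD1 a) //= big1 ?addr0 => [|b ba].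
  by rewrite mxE !eqxx mul1r.
by rewrite mxE (negPf ba) andbF mul0r.
Qed.
End MaximumInSpace.

(** Only later times are compared, so this also covers the initial time, where
the derivative is one-sided. *)
Lemma max_in_time (R : realType) (n : nat) (T : R) (F : R -> 'rV[R]_n -> R) t x l :
  0 <= t < T -> has_pd T None F t x l ->
  (forall s, t < s <= T -> F s x <= F t x) -> l <= 0.
Proof.
move=> /andP[t0 tT] H Fmax; rewrite leNgt; apply/negP => l0.
have H' : (F s x - F t x) / (s - t) @[s --> within [set s | 0 <= s <= T] t^'] --> l := H.
have PF : ProperFilter (within [set s | 0 <= s <= T] t^').
  by apply: (@pfilter_proper R n T _ None); [exact: le_lt_trans tT | rewrite t0 ltW].
have H2 : \forall s \near nbhs t, s != t -> 0 <= s <= T -> 0 < (F s x - F t x) / (s - t).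
  by move/cvgr_gt/(_ _ l0) : H'.
have /nbhs_ballP[e /= e0 He] := H2.
pose d := Num.min e (T - t) / 2.
have m0 : 0 < Num.min e (T - t) by rewrite lt_min e0 subr_gt0.
have d0 : 0 < d by rewrite divr_gt0.
have dm : d < Num.min e (T - t) by rewrite /d; move: (Num.min _ _) m0 => q; lra.
move: dm; rewrite lt_min => /andP[de dT].
have := He (t + d); rewrite -ball_normE /= opprD addrA subrr sub0r normrN gtr0_norm //.
have td : t < t + d <= T by apply/andP; split; lra.
move=> /(_ de) /(_ _) /(_ _); rewrite addrAC subrr add0r.
have -> : t + d != t by rewrite gt_eqF //; case/andP: td.
have -> : 0 <= t + d <= T by case/andP: td => ? ->; rewrite addr_ge0 // ltW.
move=> /(_ isT isT); rewrite ltNge => /negP; apply.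
by rewrite pmulr_lle0 ?invr_gt0 // subr_le0 Fmax.
Qed.

(** * The ring of smooth functions on [0, T] x V *)

Section SmoothRing.
Context {R : realType} {n : nat}.
Variables (T : R) (V : set 'rV[R]_n).

Definition smooth_pred : {pred (R -> 'rV[R]_n -> R)} :=
  fun F => `[< smooth_spacetime T V F >].

(** The hypotheses on [T] and [V] are parameters of the type because stability
of smoothness under products depends on them, and the ring structure has to
be found from the type. *)
Record smoothfn (hT : 0 < T) (hV : open V) := SFun {
  smoothfn_val : R -> 'rV[R]_n -> R;
  smoothfn_smooth : smoothfn_val \in smooth_pred }.

Variables (hT : 0 < T) (hV : open V).

Lemma smooth_subring : subring_closed smooth_pred.
Proof.
split.
- by apply/asboolP => k; exact: Ck_cst.
- move=> F G /asboolP sF /asboolP sG; apply/asboolP => k.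
  have -> : F - G = (fun t x => F t x + (- 1) * G t x).
    by apply/funext => t; apply/funext => x; rewrite mulN1r.
  by apply: CkD => //; apply: CkM => //; exact: Ck_cst.
- move=> F G /asboolP sF /asboolP sG; apply/asboolP => k.
  exact: CkM.
Qed.

HB.instance Definition _ := [isSub for @smoothfn_val hT hV].
HB.instance Definition _ := [Choice of smoothfn hT hV by <:].
HB.instance Definition _ := GRing.SubChoice_isSubComPzRing.Build
  (R -> 'rV[R]_n -> R) smooth_pred (smoothfn hT hV) smooth_subring.

Local Notation sf := (smoothfn hT hV).

Lemma sf_smooth (F : sf) : smooth_spacetime T V (smoothfn_val F).
Proof. exact/asboolP/(smoothfn_smooth F). Qed.

Definition mk_sf (F : R -> 'rV[R]_n -> R) (sF : smooth_spacetime T V F) : sf :=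
  SFun hT hV (asboolT sF : F \in smooth_pred).

Definition ev (t : R) (x : 'rV[R]_n) (F : sf) : R := smoothfn_val F t x.

Lemma ev_is_zmod t x : zmod_morphism (ev t x).
Proof. by []. Qed.
Lemma ev_is_monoid t x : monoid_morphism (ev t x).
Proof. by []. Qed.
HB.instance Definition _ t x :=
  GRing.isZmodMorphism.Build sf R (ev t x) (ev_is_zmod t x).
HB.instance Definition _ t x :=
  GRing.isMonoidMorphism.Build sf R (ev t x) (ev_is_monoid t x).

Lemma ev1 t x : ev t x 1 = 1. Proof. by []. Qed.
Lemma evD t x F G : ev t x (F + G) = ev t x F + ev t x G. Proof. by []. Qed.
Lemma evN t x F : ev t x (- F) = - ev t x F. Proof. by []. Qed.
Lemma evM t x F G : ev t x (F * G) = ev t x F * ev t x G. Proof. by []. Qed.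
Lemma ev_sum t x (J : finType) (F : J -> sf) :
  ev t x (\sum_j F j) = \sum_j ev t x (F j).
Proof. exact: rmorph_sum. Qed.

Lemma sf_ext (F G : sf) : (forall t x, ev t x F = ev t x G) -> F = G.
Proof. by move=> FG; apply/val_inj/funext => t; apply/funext => x; exact: FG. Qed.

(** Elements of the ring are functions on the whole of R x R^n, and equality in
the ring sees their values outside the slab.  Replacing these values by simple
ones makes the identities of the ring hold outside the slab too. *)
Definition patched (F G : R -> 'rV[R]_n -> R) (t : R) (x : 'rV[R]_n) : R :=
  if `[< 0 <= t <= T /\ V x >] then F t x else G t x.

Lemma patched_in F G t x : 0 <= t <= T -> V x -> patched F G t x = F t x.
Proof. by move=> tT Vx; rewrite /patched asboolT. Qed.

Lemma patched_out F G t x : ~ (0 <= t <= T /\ V x) -> patched F G t x = G t x.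
Proof. by move=> H; rewrite /patched asboolF. Qed.

Lemma patched_smooth F G : smooth_spacetime T V F ->
  smooth_spacetime T V (patched F G).
Proof.
by move=> sF k; apply: Ck_eq (sF k) => // t x tT Vx; rewrite patched_in.
Qed.

Lemma pd_smooth o F : smooth_spacetime T V F -> smooth_spacetime T V (pd T o F).
Proof. by move=> sF k; exact: Ck_pd. Qed.

(** With the value 0 outside the slab, the Leibniz rule and the commutation of
derivatives are true everywhere. *)
Definition der (o : option 'I_n) (F : sf) : sf :=
  mk_sf (patched_smooth (fun _ _ => 0) (pd_smooth o (sf_smooth F))).

Lemma ev_der o F t x : 0 <= t <= T -> V x ->
  ev t x (der o F) = pd T o (smoothfn_val F) t x.
Proof. exact: patched_in. Qed.

Lemma ev_der_out o F t x : ~ (0 <= t <= T /\ V x) -> ev t x (der o F) = 0.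
Proof. exact: patched_out. Qed.

Lemma sf_has (F : sf) o t x : 0 <= t <= T -> V x ->
  has_pd T o (smoothfn_val F) t x (ev t x (der o F)).
Proof.
move=> tT Vx; rewrite ev_der //.
exact: (@Ck_has _ _ _ _ 0 _ (sf_smooth F 1%N) o t x).
Qed.

Lemma der_val (F : sf) H o t x l : (forall t x, ev t x F = H t x) ->
  0 <= t <= T -> V x -> has_pd T o H t x l -> ev t x (der o F) = l.
Proof.
move=> FH tT Vx; have -> : H = smoothfn_val F.
  by apply/funext => s; apply/funext => y; rewrite -FH.
by rewrite ev_der //; exact: has_pd_val.
Qed.

Lemma derD o F G : der o (F + G) = der o F + der o G.
Proof.
apply: sf_ext => t x; rewrite evD.
have [[tT Vx]|out] := pselect (0 <= t <= T /\ V x); last first.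
  by rewrite !ev_der_out // addr0.
exact: (der_val (fun s y => evD s y F G) tT Vx (has_pdD hT tT (@sf_has F o t x tT Vx) (@sf_has G o t x tT Vx))).
Qed.

Lemma derM o F G : der o (F * G) = der o F * G + F * der o G.
Proof.
apply: sf_ext => t x; rewrite evD !evM.
have [[tT Vx]|out] := pselect (0 <= t <= T /\ V x); last first.
  by rewrite !ev_der_out // mul0r mulr0 addr0.
exact: (der_val (fun s y => evM s y F G) tT Vx (has_pdM hT tT (@sf_has F o t x tT Vx) (@sf_has G o t x tT Vx))).
Qed.

Lemma derC o p F : der o (der p F) = der p (der o F).
Proof.
apply: sf_ext => t x.
have [[tT Vx]|out] := pselect (0 <= t <= T /\ V x); last first.
  by rewrite !ev_der_out.
have dd q r : ev t x (der q (der r F)) = pd T q (pd T r (smoothfn_val F)) t x.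
  apply: (der_val (H := smoothfn_val (der r F))) => //; apply: (@has_pd_eq _ _ T V hT hV _ (pd T r (smoothfn_val F))) => //.
    by move=> s y sT Vy; rewrite -ev_der.
  exact: (@Ck_has _ _ _ _ 0 _ (Ck_pd r (sf_smooth F 2%N)) q t x).
rewrite !dd; exact: (pd_comm hT hV o p (sf_smooth F 2%N) tT Vx).
Qed.

Lemma smooth_cst (a : R) : smooth_spacetime T V (fun _ _ => a).
Proof. by move=> k; exact: Ck_cst. Qed.

Definition half_fun : sf := mk_sf (smooth_cst 2^-1).

Lemma half_fun2 : half_fun * 2 = 1.
Proof.
apply: sf_ext => t x; rewrite evM ev1 (_ : ev t x 2 = 2) // [ev t x half_fun]/(2^-1) mulVf //.
Qed.
End SmoothRing.

(** * The metric of a chart as a matrix over the ring of smooth functions *)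

Section ChartGeometry.
Context {R : realType} {n : nat}.
Variables (T : R) (V : set 'rV[R]_n) (hT : 0 < T) (hV : open V).
Variable g : R -> 'rV[R]_n -> 'M[R]_n.
Hypothesis g_sym : forall t x, 0 <= t <= T -> V x -> (g t x)^T = g t x.
Hypothesis g_pos : forall t x, 0 <= t <= T -> V x ->
  forall v : 'rV[R]_n, v != 0 -> 0 < (v *m g t x *m v^T) 0 0.
Hypothesis g_smooth : forall a b, smooth_spacetime T V (fun t x => g t x a b).

Local Notation sf := (smoothfn hT hV).
Local Notation D := (@der R n T V hT hV).

(** The identity matrix outside the slab keeps the determinant invertible in
the ring. *)
Definition metric_entry a b : sf :=
  mk_sf hT hV (patched_smooth hT hV (fun _ _ => (a == b)%:R) (g_smooth a b)).
Definition metric_mx : 'M[sf]_n := \matrix_(a, b) metric_entry a b.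

Lemma ev_metric_mx t x a b : 0 <= t <= T -> V x -> ev t x (metric_mx a b) = g t x a b.
Proof. by move=> tT Vx; rewrite mxE; exact: patched_in. Qed.

Lemma metric_mx_in t x : 0 <= t <= T -> V x -> map_mx (ev t x) metric_mx = g t x.
Proof. by move=> tT Vx; apply/matrixP => a b; rewrite mxE ev_metric_mx. Qed.

Lemma metric_mx_out t x : ~ (0 <= t <= T /\ V x) -> map_mx (ev t x) metric_mx = 1%:M.
Proof.
by move=> out; apply/matrixP => a b; rewrite !mxE; exact: patched_out.
Qed.

Lemma g_det t x : 0 <= t <= T -> V x -> \det (g t x) != 0.
Proof.
move=> tT Vx; apply/negP => /det0P[v v0 vg].
by have := g_pos tT Vx v0; rewrite vg mul0mx mxE ltxx.
Qed.

Lemma ev_det t x : ev t x (\det metric_mx) != 0.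
Proof.
rewrite -det_map_mx.
have [[tT Vx]|out] := pselect (0 <= t <= T /\ V x).
  by rewrite metric_mx_in //; exact: g_det.
by rewrite metric_mx_out // det1 oner_neq0.
Qed.

Lemma det_inv_smooth : smooth_spacetime T V (fun t x => (ev t x (\det metric_mx))^-1).
Proof.
move=> k; apply: Ck_inv => //; last exact: (sf_smooth (\det metric_mx) k).
by move=> t x _ _; exact: ev_det.
Qed.

Definition det_inv : sf := mk_sf hT hV det_inv_smooth.
(** The adjugate makes the entries of the inverse visibly smooth. *)
Definition inverse_mx : 'M[sf]_n := det_inv *: \adj metric_mx.

Lemma metric_mx_sym : metric_mx^T = metric_mx.
Proof.
apply/matrixP => a b; rewrite mxE; apply: sf_ext => t x.
have [[tT Vx]|out] := pselect (0 <= t <= T /\ V x).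
  by rewrite !ev_metric_mx // -[in LHS](g_sym tT Vx) mxE.
have /matrixP/(_ b a) := metric_mx_out out; rewrite mxE => ->.
by have /matrixP/(_ a b) := metric_mx_out out; rewrite mxE => ->; rewrite !mxE eq_sym.
Qed.

Lemma det_invK : det_inv * \det metric_mx = 1.
Proof.
apply: sf_ext => t x; rewrite evM ev1.
by rewrite [ev t x det_inv]/((ev t x (\det metric_mx))^-1) mulVf // ev_det.
Qed.

Lemma metric_mxK : metric_mx *m inverse_mx = 1%:M.
Proof. by rewrite -scalemxAr mul_mx_adj scale_scalar_mx det_invK. Qed.

Lemma inverse_mxK : inverse_mx *m metric_mx = 1%:M.
Proof. by rewrite -scalemxAl mul_adj_mx scale_scalar_mx det_invK. Qed.

Lemma inverse_mx_sym : inverse_mx^T = inverse_mx.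
Proof.
have : inverse_mx^T *m metric_mx = 1%:M by rewrite -[in LHS]metric_mx_sym -trmx_mul metric_mxK trmx1.
by move/(congr1 (mulmx^~ inverse_mx)); rewrite /= -mulmxA metric_mxK mulmx1 mul1mx.
Qed.

Lemma ev_inverse_mx t x a b : 0 <= t <= T -> V x -> ev t x (inverse_mx a b) = invmx (g t x) a b.
Proof.
move=> tT Vx; suff <- : map_mx (ev t x) inverse_mx = invmx (g t x) by rewrite [RHS]mxE.
have gu : g t x \in unitmx by rewrite unitmxE unitfE g_det.
rewrite -[LHS]mulmx1 -(mulmxV gu) mulmxA -[in X in X *m _](metric_mx_in tT Vx).
by rewrite -map_mxM inverse_mxK map_mx1 mul1mx.
Qed.

(** A partial derivative in space depends only on the values in [V] at the same
time; hence each coordinate formula over the ring evaluates to the geometric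
quantity of the metric at that time. *)
Lemma ev_der_space (F : sf) H t x a : 0 <= t <= T -> V x ->
  (forall y, V y -> ev t y F = H y) ->
  ev t x (D (Some a) F) = pderiv a H x.
Proof.
move=> tT Vx FH; rewrite ev_der //=; apply: near_eq_derive.
have : \forall y \near x, V y by exact: open_nbhs_nbhs.
by apply: filterS => y; exact: FH.
Qed.

Local Notation hf := (half_fun hT hV).
Local Notation Chr := (chris D hf metric_mx inverse_mx).

Lemma ev_chris t x k i j : 0 <= t <= T -> V x ->
  ev t x (Chr k i j) = christoffel (g t) k i j x.
Proof.
move=> tT Vx; rewrite /chris evM ev_sum; congr (_ * _).
apply: eq_bigr => l _; rewrite evM ev_inverse_mx // !evD evN; congr (_ * (_ + _ - _));
  by apply: ev_der_space => // y Vy; rewrite ev_metric_mx.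
Qed.

Lemma ev_riem t x l i j k : 0 <= t <= T -> V x ->
  ev t x (riem D hf metric_mx inverse_mx l i j k) = riemann (g t) l i j k x.
Proof.
move=> tT Vx; rewrite /riem !evD evN ev_sum; congr (_ - _ + _).
- by apply: ev_der_space => // y Vy; rewrite ev_chris.
- by apply: ev_der_space => // y Vy; rewrite ev_chris.
- apply: eq_bigr => m _; rewrite evD evN.
  have evCC k1 i1 j1 k2 i2 j2 : ev t x (Chr k1 i1 j1 * Chr k2 i2 j2)
      = christoffel (g t) k1 i1 j1 x * christoffel (g t) k2 i2 j2 x.
    by rewrite evM (ev_chris k1 i1 j1 tT Vx) (ev_chris k2 i2 j2 tT Vx).
  by congr (_ - _); exact: evCC.
Qed.

Lemma ev_ric t x j k : 0 <= t <= T -> V x ->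
  ev t x (ric D hf metric_mx inverse_mx j k) = ricci (g t) j k x.
Proof.
by move=> tT Vx; rewrite /ric ev_sum; apply: eq_bigr => i _; rewrite ev_riem.
Qed.

Lemma ev_scal t x : 0 <= t <= T -> V x ->
  ev t x (scal D hf metric_mx inverse_mx) = scalar_curvature (g t) x.
Proof.
move=> tT Vx; rewrite /scal ev_sum; apply: eq_bigr => i _.
by rewrite ev_sum; apply: eq_bigr => j _; rewrite evM ev_inverse_mx // ev_ric.
Qed.

Lemma ev_hess (F : sf) H t x i j : 0 <= t <= T -> V x ->
  (forall y, V y -> ev t y F = H y) ->
  ev t x (hess D hf metric_mx inverse_mx F i j) = hessian (g t) H i j x.
Proof.
move=> tT Vx FH; rewrite /hess evD evN ev_sum; congr (_ - _).
  by apply: ev_der_space => // y Vy; exact: ev_der_space.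
by apply: eq_bigr => k _; rewrite evM ev_chris // (ev_der_space _ tT Vx FH).
Qed.

Lemma ev_lap (F : sf) H t x : 0 <= t <= T -> V x ->
  (forall y, V y -> ev t y F = H y) ->
  ev t x (lap D hf metric_mx inverse_mx F) = laplacian (g t) H x.
Proof.
move=> tT Vx FH; rewrite /lap ev_sum; apply: eq_bigr => i _.
by rewrite ev_sum; apply: eq_bigr => j _; rewrite evM ev_inverse_mx // (ev_hess _ _ tT Vx FH).
Qed.

Lemma ev_grad2 (F : sf) H t x : 0 <= t <= T -> V x ->
  (forall y, V y -> ev t y F = H y) ->
  ev t x (grad2 D inverse_mx F) = grad_sqnorm (g t) H x.
Proof.
move=> tT Vx FH; rewrite /grad2 ev_sum; apply: eq_bigr => i _.
by rewrite ev_sum; apply: eq_bigr => j _; rewrite !evM ev_inverse_mx // !(ev_der_space _ tT Vx FH).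
Qed.

Hypothesis g_flow : forall t x, 0 <= t <= T -> V x -> forall a b,
  tderiv T (fun s y => g s y a b) t x = - 2 * ricci (g t) a b x.

Local Notation Rc := (Ric D hf metric_mx inverse_mx).

Lemma ev_chris_out t x k i j : ~ (0 <= t <= T /\ V x) -> ev t x (Chr k i j) = 0.
Proof.
move=> out; rewrite /chris evM ev_sum big1 ?mulr0 // => l _.
by rewrite evM !evD evN !ev_der_out // subr0 addr0 mulr0.
Qed.

Lemma ev_ric_out t x j k : ~ (0 <= t <= T /\ V x) ->
  ev t x (ric D hf metric_mx inverse_mx j k) = 0.
Proof.
move=> out; rewrite /ric ev_sum big1 // => i _.
rewrite /riem !evD evN !ev_der_out // ev_sum big1 ?subr0 ?addr0 // => m _.
have evCC k1 i1 j1 (H : sf) : ev t x (Chr k1 i1 j1 * H) = 0.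
  by rewrite evM (ev_chris_out k1 i1 j1 out) mul0r.
by rewrite evD evN (evCC i i m) (evCC i j m) subr0.
Qed.

Lemma flow_ring : dmx D None metric_mx = - (Rc + Rc).
Proof.
apply/matrixP => a b; rewrite [LHS]mxE [RHS]mxE [X in - X]mxE [Rc a b]mxE; apply: sf_ext => t x.
rewrite evN evD.
have [[tT Vx]|out] := pselect (0 <= t <= T /\ V x); last first.
  by rewrite ev_der_out // ev_ric_out // addr0 oppr0.
rewrite ev_ric //.
have -> : - (ricci (g t) a b x + ricci (g t) a b x) = - 2 * ricci (g t) a b x.
  by ring.
rewrite -g_flow //.
apply: (@der_val _ _ T V hT hV _ (smoothfn_val (metric_entry a b))) => //.
  by move=> s y; rewrite mxE.
have H := @Ck_has _ _ _ _ 0 _ (g_smooth a b 1%N) None t x tT Vx.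
apply: (has_pd_eq hT hV tT Vx _ H) => s y sT Vy.
by rewrite -[RHS]/(ev s y (metric_entry a b)) -ev_metric_mx // mxE.
Qed.

(** Twice Ric is minus the time derivative of a symmetric matrix. *)
Lemma Ric_sym_ring : Rc^T = Rc.
Proof.
have E : (Rc + Rc)^T = Rc + Rc.
  apply: oppr_inj; rewrite -flow_ring -[in LHS]linearN /= -flow_ring.
  by rewrite -dmx_tr metric_mx_sym.
apply/matrixP => a b; have /matrixP/(_ a b) := E.
have tr2 (Q : 'M[sf]_n) i j : (Q + Q)^T i j = Q j i + Q j i by rewrite !mxE.
have dbl (Q : 'M[sf]_n) i j : (Q + Q) i j = Q i j + Q i j by rewrite !mxE.
rewrite tr2 dbl => E2; have e := addr_self_inj (half_fun2 hT hV) E2.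
by rewrite -e; move: (Rc) => Q; rewrite mxE.
Qed.
End ChartGeometry.

(** * The Harnack quantity in a chart *)

Section ChartHarnack.
Context {R : realType} {n : nat}.
Variables (T : R) (V : set 'rV[R]_n) (hT : 0 < T) (hV : open V).
Variable g : R -> 'rV[R]_n -> 'M[R]_n.
Hypothesis g_sym : forall t x, 0 <= t <= T -> V x -> (g t x)^T = g t x.
Hypothesis g_pos : forall t x, 0 <= t <= T -> V x ->
  forall v : 'rV[R]_n, v != 0 -> 0 < (v *m g t x *m v^T) 0 0.
Hypothesis g_smooth : forall a b, smooth_spacetime T V (fun t x => g t x a b).
Hypothesis g_flow : forall t x, 0 <= t <= T -> V x -> forall a b,
  tderiv T (fun s y => g s y a b) t x = - 2 * ricci (g t) a b x.

Variable F : R -> 'rV[R]_n -> R.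
Hypothesis F_pos : forall t x, 0 <= t <= T -> V x -> 0 < F t x.
Hypothesis F_smooth : smooth_spacetime T V F.
Hypothesis F_heat : forall t x, 0 <= t <= T -> V x ->
  tderiv T F t x = - laplacian (g t) (F t) x + scalar_curvature (g t) x * F t x.

Local Notation sf := (smoothfn hT hV).
Local Notation D := (@der R n T V hT hV).
Local Notation hf := (half_fun hT hV).
Local Notation G := (@metric_mx R n T V hT hV g g_smooth).
Local Notation K := (@inverse_mx R n T V hT hV g g_pos g_smooth).

(** The value 1 outside the slab keeps the function positive, so that it has an
inverse and a logarithm in the ring. *)
Definition density : sf := mk_sf hT hV (patched_smooth hT hV (fun _ _ => 1) F_smooth).

Lemma ev_density t x : 0 <= t <= T -> V x -> ev t x density = F t x.
Proof. exact: patched_in. Qed.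

Lemma density_pos t x : 0 < ev t x density.
Proof.
have [[tT Vx]|out] := pselect (0 <= t <= T /\ V x).
  by rewrite ev_density //; exact: F_pos.
by rewrite [ev _ _ _]patched_out.
Qed.

Lemma density_inv_smooth : smooth_spacetime T V (fun t x => (ev t x density)^-1).
Proof.
move=> k; apply: Ck_inv => //; last exact: (sf_smooth density k).
by move=> t x _ _; exact/lt0r_neq0/density_pos.
Qed.

Definition density_inv : sf := mk_sf hT hV density_inv_smooth.

Lemma ln_smooth : smooth_spacetime T V (fun t x => ln (ev t x density)).
Proof.
move=> k; apply: Ck_ln => //; last exact: (sf_smooth density k).
by move=> t x _ _; exact: density_pos.
Qed.

(** The function u. *)
Definition potential : sf := - mk_sf hT hV ln_smooth.

Lemma density_invK : density_inv * density = 1.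
Proof.
apply: sf_ext => t x; rewrite evM ev1 [ev t x density_inv]/((ev t x density)^-1) mulVf //.
exact/lt0r_neq0/density_pos.
Qed.

Lemma ev_potential t x : 0 <= t <= T -> V x -> ev t x potential = - ln (F t x).
Proof. by move=> tT Vx; rewrite evN -ev_density. Qed.

Lemma der_potential o : D o potential = - (density_inv * D o density).
Proof.
rewrite /potential (derN (@derD _ _ _ _ hT hV)); congr (- _); apply: sf_ext => t x.
rewrite evM; have [[tT Vx]|out] := pselect (0 <= t <= T /\ V x); last first.
  by rewrite !ev_der_out // mulr0.
apply: (@der_val _ _ T V hT hV _ (fun t x => ln (ev t x density))) => //.
apply: (has_pd_comp hT tT (@sf_has _ _ _ _ _ _ density o t x tT Vx)).
exact/is_derive1_ln/density_pos.
Qed.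

Lemma ev_lap_out t x (H : sf) : ~ (0 <= t <= T /\ V x) ->
  ev t x (lap D hf G K H) = 0.
Proof.
move=> out; rewrite /lap ev_sum big1 // => i _; rewrite ev_sum big1 // => j _.
rewrite (evM t x (K i j)) /hess evD evN ev_der_out // ev_sum big1 ?subr0 ?mulr0 // => k _.
by rewrite (evM t x (chris D hf G K k i j)) ev_der_out // mulr0.
Qed.

Lemma ev_scal_out t x : ~ (0 <= t <= T /\ V x) -> ev t x (scal D hf G K) = 0.
Proof.
move=> out; rewrite /scal ev_sum big1 // => i _; rewrite ev_sum big1 // => j _.
by rewrite (evM t x (K i j)) ev_ric_out // mulr0.
Qed.

Lemma heat_ring : D None density = - lap D hf G K density + scal D hf G K * density.
Proof.
apply: sf_ext => t x; rewrite evD evN (evM t x (scal D hf G K)).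
have [[tT Vx]|out] := pselect (0 <= t <= T /\ V x); last first.
  by rewrite ev_der_out // ev_lap_out // ev_scal_out // mul0r oppr0 addr0.
rewrite ev_scal // (ev_lap _ _ tT Vx (fun y Vy => ev_density tT Vy)) ev_density // -F_heat //.
apply: (@der_val _ _ T V hT hV _ (smoothfn_val density)) => //.
have H := @Ck_has _ _ _ _ 0 _ (F_smooth 1%N) None t x tT Vx.
by apply: (has_pd_eq hT hV tT Vx _ H) => s y sT Vy; rewrite -ev_density.
Qed.

Definition harnack_fn : sf := harnack D hf G K potential.

Lemma potential_evolution :
  D None potential = - lap D hf G K potential + grad2 D K potential - scal D hf G K.
Proof.
exact: (log_conjugate_heat (@derD _ _ _ _ hT hV) (@derM _ _ _ _ hT hV)
  density_invK der_potential heat_ring).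
Qed.

Definition harnack_val (t : R) (x : 'rV[R]_n) : R :=
  2 * laplacian (g t) (fun y => - ln (F t y)) x
  - grad_sqnorm (g t) (fun y => - ln (F t y)) x + scalar_curvature (g t) x.

Lemma ev_harnack_fn t x : 0 <= t <= T -> V x -> ev t x harnack_fn = harnack_val t x.
Proof.
move=> tT Vx; rewrite /harnack_fn /harnack evD evD evN (evM t x 2) ev_scal //.
have uE y : V y -> ev t y potential = - ln (F t y) by move=> Vy; exact: ev_potential.
by rewrite (ev_lap _ _ tT Vx uE) (ev_grad2 _ _ tT Vx uE).
Qed.

Lemma harnack_val_cont : stcont T V harnack_val.
Proof.
apply: stcont_eq (Ck_cont (sf_smooth harnack_fn 0%N)) => t x tT Vx.
exact: ev_harnack_fn.
Qed.

(** The evolution equation of u trades its Laplacian for its time derivative, so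
that only first derivatives of u have to be compared between two charts. *)
Lemma harnack_val_tderiv t x : 0 <= t <= T -> V x ->
  harnack_val t x = - 2 * tderiv T (fun s y => - ln (F s y)) t x
    + grad_sqnorm (g t) (fun y => - ln (F t y)) x - scalar_curvature (g t) x.
Proof.
move=> tT Vx.
have uE y : V y -> ev t y potential = - ln (F t y) by move=> Vy; exact: ev_potential.
have /(congr1 (ev t x)) := potential_evolution.
rewrite !evD !evN ev_scal // (ev_lap _ _ tT Vx uE) (ev_grad2 _ _ tT Vx uE).
have -> : ev t x (D None potential) = tderiv T (fun s y => - ln (F s y)) t x.
  symmetry.
  apply: (has_pd_val (o := None) hT tT).
  apply: (has_pd_eq hT hV tT Vx _ (@sf_has _ _ _ _ _ _ potential None t x tT Vx)).
  by move=> s y sT Vy; rewrite -ev_potential.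
by move=> ->; rewrite /harnack_val; ring.
Qed.

Lemma harnack_evolution :
  D None harnack_fn = - lap D hf G K harnack_fn + 2 * pairing D K potential harnack_fn
    + 2 * \tr (K *m (Ric D hf G K + Hess D hf G K potential)
               *m (K *m (Ric D hf G K + Hess D hf G K potential))).
Proof.
apply: (dt_harnack (half_fun2 hT hV) (@derD _ _ _ _ hT hV) (@derM _ _ _ _ hT hV)
  (@derC _ _ _ _ hT hV)).
- exact: metric_mx_sym.
- exact: inverse_mx_sym.
- exact: metric_mxK.
- exact: inverse_mxK.
- exact: Ric_sym_ring.
- exact: flow_ring.
- exact: potential_evolution.
Qed.

Lemma slice_continuous H (t : R) (x : 'rV[R]_n) : stcont T V H -> 0 <= t <= T -> V x ->
  {for x, continuous (H t)}.
Proof.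
move=> /stcontP cH tT Vx.
have c := cH _ _ tT Vx.
suff : H t y @[y --> x] --> H t x by [].
apply: cvg_trans c => P /= HP.
have HP' : \forall y \near (t, x), slab T V y -> P (H y.1 y.2) := HP.
have c : (t, y) @[y --> x] --> (t, x) by apply: (@cvg_pair _ _ _ (nbhs x) (nbhs t) (nbhs x) _ _ _ (fun=> t) id); [exact: cvg_cst | exact: cvg_id].
have cP : \forall y \near nbhs x, slab T V (t, y) -> P (H t y) := c _ HP'.
have Vn : \forall y \near nbhs x, V y by exact: open_nbhs_nbhs.
have : \forall y \near nbhs x, P (H t y).
  by apply: filterS2 cP Vn => y h Vy; apply: h; split.
exact.
Qed.

(** The maximum principle at a point where P is maximal in space and (T - t) P
is maximal among later times. *)
Lemma chart_max t x : 0 <= t < T -> V x -> 0 <= scalar_curvature (g t) x ->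
  0 < harnack_val t x -> (forall y, V y -> harnack_val t y <= harnack_val t x) ->
  (forall s, t < s <= T -> (T - s) * harnack_val s x <= (T - t) * harnack_val t x) ->
  (T - t) * harnack_val t x <= 2 * n%:R.
Proof.
move=> /[dup] tT' /andP[t0 tT1] Vx R0 P0 Pspace Ptime.
have tT : 0 <= t <= T by rewrite t0 ltW.
have tau0 : 0 < T - t by rewrite subr_gt0.
pose p := smoothfn_val harnack_fn.
have pE s y : 0 <= s <= T -> V y -> p s y = harnack_val s y.
  by move=> sT Vy; rewrite -(ev_harnack_fn sT Vy).
have kp k : Ck_spacetime T V k p by exact: (sf_smooth harnack_fn k).
have [p1 p2] : (forall a, pderiv a (p t) x = 0) /\
  forall v : 'rV[R]_n, \sum_a \sum_b v 0 a * v 0 b * pderiv b (pderiv a (p t)) x <= 0.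
  apply: (max_in_space hV) => //.
  - by move=> a y Vy; have [_ /(_ (Some a)) [h _]] := (CkS T V 0 p).1 (kp 1%N); exact: h tT Vy.
  - move=> a b y Vy.
    have [_ /(_ (Some b)) [h _]] := (CkS T V 0 _).1 (Ck_pd (Some a) (kp 2%N)).
    exact: h tT Vy.
  - by move=> a y Vy; exact: slice_continuous (Ck_cont (Ck_pd (Some a) (kp 1%N))) tT Vy.
  - move=> a b y Vy.
    exact: slice_continuous (Ck_cont (Ck_pd (Some b) (Ck_pd (Some a) (kp 2%N)))) tT Vy.
  - by move=> y Vy; rewrite !pE //; exact: Pspace.
(* The positivity of the inverse metric, from that of the metric on [v *m Kr]. *)
pose Kr := invmx (g t x).
have KE : map_mx (ev t x) K = Kr.
  by apply/matrixP => a b; rewrite mxE ev_inverse_mx.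
have Ks : K^T = K by exact: inverse_mx_sym.
have Krs : Kr^T = Kr by rewrite -KE map_trmx Ks.
have gu : g t x \in unitmx by rewrite unitmxE unitfE (g_det g_pos tT Vx).
have Krp v : 0 <= bform Kr v v.
  rewrite /bform; have -> : v *m Kr *m v^T = (v *m Kr) *m g t x *m (v *m Kr)^T.
    by rewrite trmx_mul Krs !mulmxA mulmxKV.
  have [->|v0] := eqVneq (v *m Kr) 0; first by rewrite !mul0mx mxE.
  exact/ltW/g_pos.
have D1 a : ev t x (D (Some a) harnack_fn) = 0 by rewrite ev_der // -[RHS](p1 a).
have D2 a b : ev t x (D (Some b) (D (Some a) harnack_fn)) = pderiv b (pderiv a (p t)) x.
  apply: ev_der_space => // y Vy; exact: ev_der.
have E := harnack_evolution; set M := K *m (_ + _) *m _ in E.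
have mE (B : 'M[sf]_n) i j : map_mx (ev t x) B i j = ev t x (B i j) by rewrite mxE.
(* The gradient vanishes, so the covariant Hessian is the coordinate one, which
   is negative semidefinite. *)
have lap_le0 : ev t x (lap D hf G K harnack_fn) <= 0.
  rewrite (lapE _ _ _ Ks) -trace_map_mx map_mxM KE.
  apply: psd_trace_le0 => // v; apply: le_trans (p2 v).
  rewrite le_eqVlt; apply/orP; left; apply/eqP.
  rewrite /bform mxE exchange_big; apply: eq_bigr => a _.
  rewrite mxE mulr_suml; apply: eq_bigr => b _.
  rewrite mE [v^T _ _]mxE [Hess _ _ _ _ _ _ _]mxE /hess evD evN ev_sum big1 ?subr0 => [|k _]; last first.
    by rewrite (evM t x (chris D hf G K k b a)) D1 mulr0.
  by rewrite derC D2; ring.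
have pair0 : ev t x (pairing D K potential harnack_fn) = 0.
  by rewrite /pairing ev_sum big1 // => l _; rewrite evM D1 mulr0.
pose S := map_mx (ev t x) (Ric D hf G K + Hess D hf G K potential).
have Ss : S^T = S.
  rewrite /S map_trmx mx_trD Ric_sym_ring // Hess_sym //; first exact: derC.
  exact: metric_mx_sym.
have ME : ev t x (\tr M) = \tr (Kr *m S *m (Kr *m S)).
  by rewrite -trace_map_mx !map_mxM KE.
have trS : 2 * \tr (Kr *m S) = harnack_val t x
     + grad_sqnorm (g t) (fun y => - ln (F t y)) x + scalar_curvature (g t) x.
  have -> : \tr (Kr *m S) = ev t x (scal D hf G K + lap D hf G K potential).
    by rewrite (scalE _ _ _ Ks) (lapE _ _ _ Ks) -mxtraceD -mulmxDr -trace_map_mx map_mxM KE.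
  have uE y : V y -> ev t y potential = - ln (F t y) by move=> Vy; exact: ev_potential.
  rewrite evD ev_scal // (ev_lap _ _ tT Vx uE) /harnack_val; ring.
have grad0 : 0 <= grad_sqnorm (g t) (fun y => - ln (F t y)) x.
  pose v : 'rV[R]_n := \row_a pderiv a (fun y => - ln (F t y)) x.
  suff <- : bform Kr v v = grad_sqnorm (g t) (fun y => - ln (F t y)) x by [].
  rewrite /bform /grad_sqnorm mxE exchange_big; apply: eq_bigr => a _.
  rewrite mxE mulr_suml; apply: eq_bigr => b _.
  have vE c : v 0 c = pderiv c (fun y => - ln (F t y)) x by rewrite mxE.
  by rewrite [v^T _ _]mxE !vE [_ * Kr _ _]mulrC.
have trM : (harnack_val t x / 2) ^+ 2 <= n%:R * \tr (Kr *m S *m (Kr *m S)).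
  apply: le_trans (psd_trace_square Krs Krp Ss).
  have h : harnack_val t x / 2 <= \tr (Kr *m S).
    by rewrite ler_pdivrMr // mulrC trS -addrA lerDl addr_ge0.
  have h0 : 0 <= harnack_val t x / 2 by rewrite divr_ge0 // ltW.
  by rewrite ler_sqr ?nnegrE // (le_trans h0 h).
have dtP : - harnack_val t x + (T - t) * ev t x (D None harnack_fn) <= 0.
  apply: (@max_in_time _ _ T (fun s y => (T - s) * p s y) t x) => //.
    have -> : - harnack_val t x + (T - t) * ev t x (D None harnack_fn)
            = (0 - 1) * p t x + (T - t) * ev t x (D None harnack_fn).
      by rewrite pE //; ring.
    apply: (has_pdM hT tT); last exact: (@sf_has _ _ _ _ _ _ harnack_fn None t x tT Vx).
    have PF := @pfilter_proper R n T hT None t tT.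
    have h1 : has_pd T None (fun (s : R) (_ : 'rV[R]_n) => - s) t x (- 1).
      rewrite /has_pd /quot_cvg /=.
      have c : (fun=> - 1 : R) s @[s --> within [set s | 0 <= s <= T] t^'] --> (- 1 : R).
        exact: cvg_cst.
      apply: cvg_trans c; apply: near_eq_cvg.
      apply: filterS (@pinc_neq0 R n T None t) => s /= s0.
      have -> : - s - - t = - (s - t) by ring.
      by rewrite mulNr mulfV.
    have := has_pdD hT tT (has_pd_cst hT None T x tT) h1.
    exact.
  by move=> s st; rewrite !pE //; [exact: Ptime | case/andP: st => /ltW st ->; rewrite (le_trans t0)].
have Et : ev t x (D None harnack_fn) >= 2 * \tr (Kr *m S *m (Kr *m S)).
  rewrite E !evD evN (evM t x 2 (pairing _ _ _ _)) pair0 mulr0 addr0 (evM t x 2) ME.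
  by rewrite lerDr oppr_ge0.
(* In what follows P >= 2 (T - t) q and q >= P^2 / (4 n), with q = |S|^2; the
   factor n is kept on the other side because n may be 0. *)
set P := harnack_val t x in P0 dtP trM *; set q := \tr _ in trM Et *.
set d := ev _ _ _ in dtP Et; set tau := T - t in tau0 dtP *.
have e1 : tau * (2 * q) <= P.
  apply: (@le_trans _ _ (tau * d)); first by rewrite ler_pM2l.
  by rewrite -subr_le0 addrC.
have e2 : tau * (2 * (P / 2) ^+ 2) <= n%:R * P.
  apply: (@le_trans _ _ (n%:R * (tau * (2 * q)))).
    rewrite [leRHS](_ : _ = tau * (2 * (n%:R * q))); last by ring.
    by rewrite ler_pM2l // ler_pM2l.
  exact: ler_wpM2l.
rewrite -(ler_pM2r P0); apply: le_trans (_ : tau * (2 * (P / 2) ^+ 2) * 2 <= _).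
  by rewrite le_eqVlt; apply/orP; left; apply/eqP; field.
have -> : 2 * n%:R * P = n%:R * P * 2 by ring.
by rewrite ler_pM2r.
Qed.
End ChartHarnack.

(** * Independence of the chart and the maximum over the manifold *)

Section CongruentMetrics.
Variables (R : fieldType) (n : nat) (gi gj J : 'M[R]_n).
Hypothesis giE : gi = J^T *m gj *m J.
Hypothesis gi_unit : gi \in unitmx.

Lemma congruent_inverse : J *m invmx gi *m J^T = invmx gj.
Proof.
have := gi_unit; rewrite {1}giE !unitmx_mul => /andP[/andP[JTu gju] Ju].
have E : gj *m (J *m invmx gi *m J^T) = 1%:M.
  have -> : gj = invmx J^T *m gi *m invmx J.
    by rewrite giE !mulmxA mulVmx // mul1mx mulmxK.
  by rewrite !mulmxA mulmxKV // mulmxK // mulVmx.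
by have := congr1 (mulmx (invmx gj)) E; rewrite mulKmx // mulmx1.
Qed.

Lemma congruent_trace (Qi Qj : 'M[R]_n) : Qi = J^T *m Qj *m J ->
  \tr ((invmx gi)^T *m Qi) = \tr ((invmx gj)^T *m Qj).
Proof.
move=> ->; rewrite -congruent_inverse !trmx_mul trmxK.
by rewrite !mulmxA mxtrace_mulC !mulmxA.
Qed.

Lemma congruent_form (vi vj : 'rV[R]_n) : vi = vj *m J ->
  vi *m invmx gi *m vi^T = vj *m invmx gj *m vj^T.
Proof. by move=> ->; rewrite -congruent_inverse trmx_mul !mulmxA. Qed.
End CongruentMetrics.

Section Manifold.
Context {R : realType} {n : nat} {M : topologicalType}.
Variables (A : smooth_atlas R n M) (T : R).
Variables (g : chart A -> R -> 'rV[R]_n -> 'M[R]_n) (f : R -> M -> R).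
Hypothesis T_gt0 : 0 < T.
Hypothesis M_compact : compact [set: M].
Hypothesis g_flow : ricci_flow T g.
Hypothesis g_scal : nonneg_scalar_curvature T g.
Hypothesis f_pos : forall (t : R) p, 0 <= t <= T -> 0 < f t p.
Hypothesis f_heat : conjugate_heat_solution T g f.
Implicit Types (i j : chart A) (p q : M).

Let image_open i : open (chart_image i) := @chart_image_open _ _ _ A i.
Let g_sym i := metric_symmetric g_flow.1 (i := i).
Let g_pos i := metric_posdef g_flow.1 (i := i).
Let g_smooth i := metric_smooth g_flow.1 i.
Let F i := in_chart i f.
Let F_pos i (t : R) x : 0 <= t <= T -> chart_image i x -> 0 < F i t x.
Proof. by move=> tT _; exact: f_pos. Qed.
Let F_smooth i : smooth_spacetime T (chart_image i) (F i) := f_heat.1 i.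
Let F_heat i := f_heat.2 i.
Let u i (t : R) (y : 'rV[R]_n) := - ln (F i t y).

Lemma image_chart i p : chart_dom i p -> chart_image i (chart_map i p).
Proof. by move=> ip; exists p. Qed.

Lemma u_smooth i : smooth_spacetime T (chart_image i) (u i).
Proof.
move=> k; have L : Ck_spacetime T (chart_image i) k (fun t x => ln (F i t x)).
  by apply: Ck_ln => //; [move=> t x; exact: F_pos | exact: F_smooth].
have := CkM T_gt0 (@image_open i) (Ck_cst T_gt0 (@image_open i) k (- 1)) L.
by apply: Ck_eq => // t x _ _; rewrite mulN1r.
Qed.

Lemma chart_map_continuous_at i p : chart_dom i p ->
  chart_map i q @[q --> p] --> chart_map i p.
Proof.
move=> ip; have := @chart_map_continuous _ _ _ A i.
rewrite continuous_open_subspace; last exact: chart_dom_open.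
by move=> /(_ p); rewrite inE; apply.
Qed.

Lemma chart_inv_continuous_at i p : chart_dom i p ->
  chart_inv i y @[y --> chart_map i p] --> p.
Proof.
move=> ip; have := @chart_inv_continuous _ _ _ A i.
rewrite continuous_open_subspace; last exact: chart_image_open.
move=> /(_ (chart_map i p)); rewrite inE => /(_ (image_chart ip)).
by rewrite /continuous_at chart_mapK.
Qed.

(** The differential of u in two charts: the transition map is composed along
coordinate lines only, so [chain_curve] is all the chain rule that is
needed. *)
Lemma chain_transition i j p t a : 0 <= t <= T -> chart_dom i p -> chart_dom j p ->
  pderiv a (u i t) (chart_map i p) =
  \sum_c transition_jacobian i j (chart_map i p) c a
         * pderiv c (u j t) (chart_map j p).
Proof.
move=> tT ip jp; set x := chart_map i p; set y := chart_map j p.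
pose phi z := chart_map j (chart_inv i z).
have phix : phi x = y by rewrite /phi /x chart_mapK.
pose e : 'rV[R]_n := delta_mx 0 a.
pose gam c (h : R) := phi (h *: e + x) 0 c - phi x 0 c.
have H : quot0 (fun h => u j t (\sum_c gam c h *: delta_mx 0 c + y)) (u j t y)
    (\sum_c transition_jacobian i j x c a * pderiv c (u j t) y).
  have ku := u_smooth j.
  have yV : chart_image j y by exact: image_chart.
  have Vn : \forall z \near y, chart_image j z.
    by apply: open_nbhs_nbhs; split => //; exact: image_open.
  apply: chain_curve => c.
  - apply: filterS Vn => z Vz.
    have [_ /(_ (Some c)) [h _]] := (CkS T (chart_image j) 0 (u j)).1 (ku 1%N).
    exact: h tT Vz.
  - apply: (slice_continuous (@image_open j) (Ck_cont (Ck_pd (Some c) (ku 1%N))) tT yV).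
  - have [_ /(_ a)[dphi _]] := @chart_transition_smooth _ _ _ A i j c 1%N.
    have {dphi} := dphi x (ex_intro2 _ _ p (conj ip jp) erefl).
    move=> dphi; have : (fun h : R => h^-1 *: (((fun z => phi z 0 c) \o shift x) (h *: e)
        - phi x 0 c)) @ 0^' --> transition_jacobian i j x c a by exact: dphi.
    rewrite /quot0 /quot_cvg; apply: cvg_trans; apply: near_eq_cvg.
    by apply: filterE => h; rewrite /= subr0 mulrC.
have near_dom : \forall z \near x, chart_dom j (chart_inv i z) /\ chart_image i z.
  have n1 : \forall q \near p, chart_dom j q.
    by apply: open_nbhs_nbhs; split => //; exact: chart_dom_open.
  have n2 : \forall z \near x, chart_dom j (chart_inv i z) := chart_inv_continuous_at ip n1.
  have n3 : \forall z \near x, chart_image i z.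
    by apply: open_nbhs_nbhs; split; [exact: image_open | exact: image_chart].
  exact: filterI n2 n3.
have near_h : \forall h \near (0 : R), chart_dom j (chart_inv i (h *: e + x)).
  have c : (h *: e + x) @[h --> (0 : R)] --> x.
    rewrite -[X in _ --> X](add0r x) -(scale0r e).
    by apply: cvgD; [apply: cvgZr_tmp; exact: cvg_id | exact: cvg_cst].
  have cn : \forall h \near (0 : R), chart_dom j (chart_inv i (h *: e + x))
      /\ chart_image i (h *: e + x) := c _ near_dom.
  by apply: filterS cn => h [].
have ux : u i t x = u j t y.
  by rewrite /u /F /in_chart /x /y !chart_mapK.
apply: cvg_lim => //.
move: H; rewrite /quot0 /quot_cvg; apply: cvg_trans; apply: near_eq_cvg.
rewrite near_withinE; apply: filterS near_h => h jh _.
have -> : \sum_c gam c h *: delta_mx 0 c + y = phi (h *: e + x).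
  rewrite -phix [phi (h *: e + x)](_ : _ = (phi (h *: e + x) - phi x) + phi x);
    last by rewrite subrK.
  congr (_ + _); rewrite [RHS]row_sum_delta; apply: eq_bigr => c _.
  by rewrite !mxE.
rewrite /= ux [LHS]mulrC; congr (_ * (_ - _)).
by rewrite /u /F /in_chart /phi chart_mapK.
Qed.

Definition harnack_in_chart i := harnack_val (g i) (F i).

(** The transformation rule of the metric, differentiated in time with its
Jacobian constant, becomes that of Ric by the flow equation. *)
Lemma ricci_transition i j t p : 0 <= t <= T -> chart_dom i p -> chart_dom j p ->
  forall a b, ricci (g i t) a b (chart_map i p) =
   \sum_c \sum_d transition_jacobian i j (chart_map i p) c a
     * transition_jacobian i j (chart_map i p) d b * ricci (g j t) c d (chart_map j p).
Proof.
move=> tT ip jp a b; set x := chart_map i p; set y := chart_map j p.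
set J := transition_jacobian i j x.
have hg k (z : 'rV[R]_n) c d : chart_image k z ->
    has_pd T None (fun s w => g k s w c d) t z (- 2 * ricci (g k t) c d z).
  move=> kz; rewrite -(g_flow.2 k t z tT kz c d).
  exact: (@Ck_has _ _ _ _ 0 _ (g_smooth k c d 1%N) None t z tT kz).
have PF := @pfilter_proper R n T T_gt0 None t tT.
have l1 := hg i x a b (image_chart ip).
have l2 : (g i s x a b - g i t x a b) / (s - t) @[s --> @pfilter R n T None t] -->
   \sum_c \sum_d J c a * J d b * (- 2 * ricci (g j t) c d y).
  have c0 : \sum_c \sum_d J c a * J d b * ((g j s y c d - g j t y c d) / (s - t))
      @[s --> @pfilter R n T None t] -->
      \sum_c \sum_d J c a * J d b * (- 2 * ricci (g j t) c d y).
    apply: (@cvg_bigsum R R) => c; apply: (@cvg_bigsum R R) => d.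
    by apply: cvgM; [exact: cvg_cst | exact: hg j y c d (image_chart jp)].
  apply: cvg_trans c0; apply: near_eq_cvg.
  rewrite near_withinE; apply: filterE => s /= sT.
  rewrite /x (metric_transition g_flow.1 sT ip jp) (metric_transition g_flow.1 tT ip jp).
  rewrite -sumrB mulr_suml; apply: eq_bigr => c _.
  rewrite -sumrB mulr_suml; apply: eq_bigr => d _.
  by rewrite -mulrBr mulrA.
have E : - 2 * ricci (g i t) a b x =
    \sum_c \sum_d J c a * J d b * (- 2 * ricci (g j t) c d y).
  exact: (cvg_unique _ l1 l2).
have n2 : (- 2 : R) != 0 by rewrite oppr_eq0 pnatr_eq0.
apply: (mulfI n2); rewrite E mulr_sumr; apply: eq_bigr => c _.
by rewrite mulr_sumr; apply: eq_bigr => d _; ring.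
Qed.

(** Each term of [harnack_val_tderiv] is invariant: the time derivative is taken
at a fixed point of M, and the other two terms contract tensors with the
inverse metric. *)
Lemma harnack_transition i j t p : 0 <= t <= T -> chart_dom i p -> chart_dom j p ->
  harnack_in_chart i t (chart_map i p) = harnack_in_chart j t (chart_map j p).
Proof.
move=> tT ip jp.
have PE k : chart_dom k p -> harnack_in_chart k t (chart_map k p) =
    - 2 * tderiv T (u k) t (chart_map k p)
    + grad_sqnorm (g k t) (u k t) (chart_map k p)
    - scalar_curvature (g k t) (chart_map k p).
  move=> kp; apply: (harnack_val_tderiv T_gt0 (@image_open k) (@g_pos k) (@g_smooth k)
    (@F_pos k) (@F_smooth k) (@F_heat k) tT (image_chart kp)).
rewrite (PE i ip) (PE j jp).
pose J : 'M[R]_n := \matrix_(c, a) transition_jacobian i j (chart_map i p) c a.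
have sandwich (Q : 'M[R]_n) a b : (J^T *m Q *m J) a b =
    \sum_c \sum_d J c a * J d b * Q c d.
  rewrite mxE exchange_big; apply: eq_bigr => d _.
  rewrite mxE mulr_suml; apply: eq_bigr => c _; rewrite mxE; ring.
have gE : g i t (chart_map i p) = J^T *m g j t (chart_map j p) *m J.
  apply/matrixP => a b; rewrite sandwich (metric_transition g_flow.1 tT ip jp).
  by apply: eq_bigr => c _; apply: eq_bigr => d _; rewrite !mxE.
have gu : g i t (chart_map i p) \in unitmx.
  by rewrite unitmxE unitfE (g_det (@g_pos i) tT (image_chart ip)).
have scalE k : scalar_curvature (g k t) (chart_map k p)
  = \tr ((invmx (g k t (chart_map k p)))^T *m
         \matrix_(a, b) ricci (g k t) a b (chart_map k p)).
  rewrite /scalar_curvature exchange_big; apply: eq_bigr => b _.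
  by rewrite mxE; apply: eq_bigr => a _; rewrite !mxE.
have gradE k : grad_sqnorm (g k t) (u k t) (chart_map k p)
  = ((\row_a pderiv a (u k t) (chart_map k p)) *m invmx (g k t (chart_map k p))
     *m (\row_a pderiv a (u k t) (chart_map k p))^T) 0 0.
  pose v : 'rV[R]_n := \row_a pderiv a (u k t) (chart_map k p).
  have vE a : v 0 a = pderiv a (u k t) (chart_map k p) by rewrite mxE.
  rewrite /grad_sqnorm exchange_big mxE; apply: eq_bigr => b _.
  rewrite [(_ *m _) 0 b]mxE mulr_suml; apply: eq_bigr => a _.
  by rewrite [_^T _ _]mxE -/v !vE [invmx _ _ _ * _]mulrC.
have tderivE : tderiv T (u i) t (chart_map i p) = tderiv T (u j) t (chart_map j p).
  rewrite /tderiv.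
  have -> : tquot (u i) t (chart_map i p) = tquot (u j) t (chart_map j p) => //.
  by apply/funext => s; rewrite /tquot /u /F /in_chart !chart_mapK.
have duE : \row_a pderiv a (u i t) (chart_map i p)
         = (\row_a pderiv a (u j t) (chart_map j p)) *m J.
  apply/rowP => a; rewrite mxE (chain_transition _ tT ip jp) mxE.
  by apply: eq_bigr => c _; rewrite !mxE mulrC.
have RicE : \matrix_(a, b) ricci (g i t) a b (chart_map i p)
   = J^T *m (\matrix_(a, b) ricci (g j t) a b (chart_map j p)) *m J.
  apply/matrixP => a b; rewrite mxE (ricci_transition tT ip jp) sandwich.
  by apply: eq_bigr => c _; apply: eq_bigr => d _; rewrite !mxE.
by rewrite tderivE !gradE (congruent_form gE gu duE) !scalE (congruent_trace gE gu RicE).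
Qed.

Definition some_chart p : chart A := sval (cid (chart_cover A p)).
Lemma some_chartP p : chart_dom (some_chart p) p.
Proof. exact: (svalP (cid (chart_cover A p))). Qed.

(** P as a function on [0, T] x M; the choice of the chart is immaterial by
[harnack_transition]. *)
Definition harnack_at (t : R) p := harnack_in_chart (some_chart p) t (chart_map (some_chart p) p).

Lemma harnack_atE i t p : 0 <= t <= T -> chart_dom i p -> harnack_at t p = harnack_in_chart i t (chart_map i p).
Proof. by move=> tT ip; apply: harnack_transition => //; exact: some_chartP. Qed.

Let scaled_harnack (z : R * M) : R := (T - z.1) * harnack_at z.1 z.2.
Let timeM : set (R * M) := `[0, T]%classic `*` [set: M].

Lemma scaled_harnack_continuous : {within timeM, continuous scaled_harnack}.
Proof.
apply/subspace_continuousP => -[t p] [/=]; rewrite in_itv /= => tT _.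
pose i := some_chart p; have ip : chart_dom i p := some_chartP p.
apply: cvgM.
  apply: cvgB; first exact: cvg_cst.
  move=> P HP; have n1 : \forall z \near (t, p), P z.1 by exact: cvg_fst HP.
  suff : \forall z \near (t, p), timeM z -> P z.1 by [].
  by apply: filterS n1 => z Pz _.
have /stcontP cP : stcont T (chart_image i) (harnack_in_chart i).
  exact: (harnack_val_cont T_gt0 (@image_open i) (@g_pos i) (@g_smooth i) (@F_pos i) (@F_smooth i)).
have c := cP t _ tT (image_chart ip).
rewrite [harnack_at _ _](harnack_atE tT ip).
have psi : (z.1, chart_map i z.2) @[z --> (t, p)] --> (t, chart_map i p).
  apply: (@cvg_pair _ _ _ (nbhs (t, p)) (nbhs t) (nbhs (chart_map i p))).
    exact: cvg_fst.
  by apply: (@cvg_comp _ _ _ (fun z : R * M => z.2) (chart_map i)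
    (nbhs (t, p)) (nbhs p)); [exact: cvg_snd | exact: chart_map_continuous_at].
have near_i : \forall z \near (t, p), chart_dom i z.2.
  have n1 : \forall q \near p, chart_dom i q.
    by apply: open_nbhs_nbhs; split => //; exact: chart_dom_open.
  exact: (cvg_snd n1).
apply: cvg_trans c => P /= HP.
have HP' : \forall z \near (t, chart_map i p), slab T (chart_image i) z ->
  P (harnack_in_chart i z.1 z.2) := HP.
have n2 : \forall z \near (t, p), slab T (chart_image i) (z.1, chart_map i z.2) ->
  P (harnack_in_chart i z.1 (chart_map i z.2)) := psi _ HP'.
suff : \forall z \near (t, p), timeM z -> P (harnack_at z.1 z.2) by [].
apply: filterS2 n2 near_i => -[s q] /= h iq [/=]; rewrite in_itv /= => sT _.
by rewrite (harnack_atE sT iq); apply: h; split => //=; exact: image_chart.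
Qed.

(** At a maximum over [0, T] x M the bound is clear when P is not positive, and
also at the time T, where the weight vanishes.  Everywhere else the maximum
is one of those of [chart_max]. *)
Lemma scaled_harnack_bound t p : 0 <= t <= T -> (T - t) * harnack_at t p <= 2 * n%:R.
Proof.
move=> tT.
have timeM_compact : compact timeM by apply: compact_setX => //; exact: segment_compact.
have timeM0 : timeM !=set0 by exists (t, p); split => //=; rewrite in_itv.
have [[s q]] := compact_EVT_max timeM0 timeM_compact scaled_harnack_continuous.
rewrite inE => -[/=]; rewrite in_itv /= => sT _ hmax.
have hmax' r q' : 0 <= r <= T -> (T - r) * harnack_at r q' <= (T - s) * harnack_at s q.
  by move=> rT; apply: (hmax (r, q')); rewrite inE; split => //=; rewrite in_itv.
apply: le_trans (hmax' t p tT) _.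
have [s0 sT'] := andP sT.
have [P0|P0] := leP (harnack_at s q) 0.
  apply: (@le_trans _ _ 0); last by rewrite mulr_ge0.
  by rewrite mulr_ge0_le0 // subr_ge0.
move: sT'; rewrite le_eqVlt => /orP[/eqP ->|sT'].
  by rewrite subrr mul0r mulr_ge0.
pose i := some_chart q; have iq : chart_dom i q := some_chartP q.
have tau0 : 0 < T - s by rewrite subr_gt0.
rewrite (harnack_atE sT iq); rewrite (harnack_atE sT iq) in P0.
apply: (chart_max T_gt0 (@image_open i) (@g_sym i) (@g_pos i) (@g_smooth i)
  (fun t x tT Vx => g_flow.2 i t x tT Vx) (@F_pos i) (@F_smooth i) (@F_heat i)).
- by rewrite s0.
- exact: image_chart.
- exact: g_scal sT (image_chart iq).
- exact: P0.
- move=> _ [q' iq' <-]; have := hmax' s q' sT.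
  by rewrite (harnack_atE sT iq) (harnack_atE sT iq') ler_pM2l.
- move=> r /andP[sr rT]; have rT' : 0 <= r <= T by rewrite rT (le_trans s0 (ltW sr)).
  by have := hmax' r q rT'; rewrite (harnack_atE sT iq) (harnack_atE rT' iq).
Qed.
End Manifold.

Theorem theorem1p3 (R : realType) (n : nat) (M : topologicalType)
    (A : smooth_atlas R n M) (T : R)
    (g : chart A -> R -> 'rV[R]_n -> 'M[R]_n) (f : R -> M -> R) :
  0 < T ->
  hausdorff_space M ->
  compact [set: M] ->
  ricci_flow T g ->
  nonneg_scalar_curvature T g ->
  (forall (t : R) p, 0 <= t <= T -> 0 < f t p) ->
  conjugate_heat_solution T g f ->
  forall (i : chart A) (t : R) (p : M), 0 <= t < T -> chart_dom i p ->
    harnack_H T g f i t p <= 0.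
Proof.
move=> T0 _ cM flow scal0 fpos heat i t p /andP[t0 tT] ip.
have tT' : 0 <= t <= T by rewrite t0 ltW.
have B := scaled_harnack_bound T0 cM flow scal0 fpos heat p tT'.
rewrite (harnack_atE T0 flow fpos heat tT' ip) in B.
have tau0 : 0 < T - t by rewrite subr_gt0.
have -> : harnack_H T g f i t p
  = harnack_in_chart g f i t (chart_map i p) - 2 * (n%:R / (T - t)) by [].
by rewrite subr_le0 mulrA ler_pdivlMr // mulrC.
Qed.
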